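(* Let $\mathscr{P}$ be a model, $\Pi$ a prior on $\mathscr{P}$ and $P^*\in\mathscr{P}$, and assume that $-P_0\log(p^*/p_0)<\infty$ and $P_0(p/p^* )<\infty$ for all $P\in\mathscr{P}$. Suppose that there exist a sequence of strictly positive numbers $\varepsilon_n$ with $\varepsilon_n\to 0$ and $n\varepsilon_n^2\to\infty$ and a constant $L>0$ such that, for all $n$, $$\Pi\bigl(B(\varepsilon_n,P^*;P_0)\bigr)\ge e^{-Ln\varepsilon_n^2},$$ $$N_t(\varepsilon,\mathscr{P},d;P_0,P^* )\le e^{n\varepsilon_n^2}\qquad\text{for all }\varepsilon>\varepsilon_n.$$ Then for every sufficiently large constant $M$, as $n\to\infty$, $$\Pi_n\bigl(P\in\mathscr{P}: d(P,P^* )\ge M\varepsilon_n\,\big|\,X_1,\ldots,X_n\bigr)\to 0\qquad\text{in }L_1(P_0^n).$$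
   Context: $X_1,X_2,\ldots$ are i.i.d. observations from a probability distribution $P_0$ on a measurable space $(\mathscr{X},\mathscr{A})$. The model $\mathscr{P}$ is a collection of probability distributions on $(\mathscr{X},\mathscr{A})$ dominated by a $\sigma$-finite measure $\mu$; $P_0$ need not belong to $\mathscr{P}$ but also has a density with respect to $\mu$. Lower case letters $p,p_0,p^*$ denote $\mu$-densities of $P,P_0,P^*$, and $(x,p)\mapsto p(x)$ is measurable for the product of $\mathscr{A}$ and an appropriate $\sigma$-field on $\mathscr{P}$. The prior $\Pi$ is a probability measure on $\mathscr{P}$ (with this $\sigma$-field). The posterior mass of a measurable set $B\subset\mathscr{P}$ is $$\Pi_n(B|X_1,\ldots,X_n)=\int_B\prod_{i=1}^n p(X_i)\,d\Pi(P)\Big/\int_{\mathscr{P}}\prod_{i=1}^n p(X_i)\,d\Pi(P)\qquad(0/0:=0).$$ $d$ is a semi-metric on $\mathscr{P}$. Write $Qf=\int f\,dQ$. Convention $\log 0=-\infty$; thus $-P_0\log(p^*/p_0)<\infty$ implies $P_0\ll P^*$, and $p^*$ is taken strictly positive at the observations. Convergence in $L_1(P_0^n)$ of posterior masses means that their expectations under $X_1,\dots,X_n$ i.i.d. $P_0$ converge. Kullback–Leibler neighbourhood: $B(\varepsilon,P^*;P_0)=\{P\in\mathscr{P}: -P_0\log\frac{p}{p^*}\le\varepsilon^2,\ P_0(\log\frac{p}{p^*})^2\le\varepsilon^2\}$. Covering number for testing under misspecification: for $\varepsilon>0$, $N_t(\varepsilon,\mathscr{P},d;P_0,P^* )$ is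 the minimal number $N$ of convex sets $B_1,\ldots,B_N$ of probability measures on $(\mathscr{X},\mathscr{A})$ (with $\mu$-densities $p$; the sets need not be contained in $\mathscr{P}$) needed to cover $\{P\in\mathscr{P}:\varepsilon<d(P,P^* )<2\varepsilon\}$ such that, for every $i$, $$\inf_{P\in B_i}\ \sup_{0<\alpha<1}-\log P_0\Bigl(\frac{p}{p^*}\Bigr)^\alpha\ge\frac{\varepsilon^2}{4};$$ it is $\infty$ if there is no finite covering of this type. *)

(* Defs.v *)
From HB Require Import structures.
From mathcomp Require Import all_boot all_order all_algebra.
From mathcomp Require Import all_classical all_reals all_analysis.

Set Implicit Arguments.
Unset Strict Implicit.
Unset Printing Implicit Defensive.

Import Order.TTheory GRing.Theory Num.Theory.
Import numFieldNormedType.Exports.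

Local Open Scope classical_set_scope.
Local Open Scope ring_scope.
Local Open Scope ereal_scope.

(* Semi-metric in the sense of a pseudometric: distinct points may be at
   distance 0. *)
Definition is_semimetric (R : realType) (T : Type) (d : T -> T -> R) : Prop :=
  [/\ forall x, d x x = 0%R,
      forall x y, (0 <= d x y)%R,
      forall x y, d x y = d y x &
      forall x y z, (d x z <= d x y + d y z)%R].

Section misspecification.
Context (R : realType) (dX : measure_display) (X : measurableType dX).

Definition is_density (mu : set X -> \bar R) (P : set X -> \bar R)
    (p : X -> R) : Prop :=
  [/\ measurable_fun setT p,
      forall x, (0 <= p x)%R &
      forall A, measurable A -> P A = \int[mu]_(x in A) (p x)%:E].

(* P0 (log (p / q)).  [lne] is the logarithm with log 0 = -oo.  If both the
   positive and the negative part have infinite integral, the value of the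
   library integral is -oo, so that - P0 (log (p / q)) = +oo. *)
Definition int_log_ratio (P0 : set X -> \bar R) (p q : X -> R) : \bar R :=
  \int[P0]_x lne (p x / q x)%:E.

Definition int_sqr_log_ratio (P0 : set X -> \bar R) (p q : X -> R) : \bar R :=
  \int[P0]_x (lne (p x / q x)%:E) ^+ 2.

Definition int_ratio_pow (P0 : set X -> \bar R) (p q : X -> R) (a : R)
    : \bar R :=
  \int[P0]_x (powR (p x / q x) a)%:E.

(* sup over 0 < a < 1 of - log P0 (p / pstar)^a. *)
Definition testing_rate (P0 : set X -> \bar R) (pstar p : X -> R) : \bar R :=
  ereal_sup [set - lne (int_ratio_pow P0 p pstar a) | a in `]0%R, 1%R[].

(* The mixture is described by its values on measurable sets, since these are
   the only values of a [probability] with a mathematical meaning.  In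
   particular (t = 1) a convex set is stable under changing a measure outside
   the sigma-field. *)
Definition convex_probabilities (B : set (probability X R)) : Prop :=
  forall (P Q S : probability X R) (t : R), B P -> B Q -> (0 <= t <= 1)%R ->
    (forall A, measurable A -> S A = t%:E * P A + (1 - t)%:E * Q A) -> B S.

(* The infimum ranges over all versions of the densities; the rate does not
   depend on the version as soon as P0 is dominated by mu. *)
Definition testing_set (mu P0 : set X -> \bar R) (pstar : X -> R) (eps : R)
    (B : set (probability X R)) : Prop :=
  [/\ convex_probabilities B,
      forall P, B P -> exists p, is_density mu P p &
      (eps ^+ 2 / 4)%:E <=
        ereal_inf [set r | exists (P : probability X R) (p : X -> R),
          [/\ B P, is_density mu P p & r = testing_rate P0 pstar p]]].

Context (dM : measure_display) (M : measurableType dM).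

Definition testing_cover (mu P0 : set X -> \bar R)
    (law : M -> probability X R) (d : M -> M -> R) (pstar : X -> R)
    (Pstar : M) (eps : R) (N : nat) : Prop :=
  exists B : 'I_N -> set (probability X R),
    (forall i, testing_set mu P0 pstar eps (B i)) /\
    (forall P : M, (eps < d P Pstar < 2 * eps)%R -> exists i, B i (law P)).

(* The infimum of the empty set is +oo. *)
Definition testing_covering_number (mu P0 : set X -> \bar R)
    (law : M -> probability X R) (d : M -> M -> R) (pstar : X -> R)
    (Pstar : M) (eps : R) : \bar R :=
  ereal_inf [set (N%:R : R)%:E | N in
    [set N | testing_cover mu P0 law d pstar Pstar eps N]].

Definition KL_neighbourhood (P0 : set X -> \bar R) (dens : M -> X -> R)
    (Pstar : M) (eps : R) : set M :=
  [set P | - int_log_ratio P0 (dens P) (dens Pstar) <= (eps ^+ 2)%:E /\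
           int_sqr_log_ratio P0 (dens P) (dens Pstar) <= (eps ^+ 2)%:E].

(* In \bar R, 0^-1 = +oo and 0 * +oo = 0, hence 0 / 0 = 0. *)
Definition posterior (Pi : set M -> \bar R) (dens : M -> X -> R) (n : nat)
    (x : nat -> X) (B : set M) : \bar R :=
  (\int[Pi]_(P in B) (\prod_(i < n) dens P (x i))%:E) /
  (\int[Pi]_P (\prod_(i < n) dens P (x i))%:E).

Definition iid (dO : measure_display) (Omega : measurableType dO)
    (Pr : probability Omega R) (P0 : probability X R)
    (Xs : nat -> {mfun Omega >-> X}) : Prop :=
  (forall i A, measurable A -> distribution Pr (Xs i) A = P0 A) /\
  (forall (s : seq nat) (A : nat -> set X), uniq s ->
     (forall i, measurable (A i)) ->
     Pr (\bigcap_(i in [set` s]) (Xs i @^-1` A i)) =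
     \prod_(i <- s) Pr (Xs i @^-1` A i)).

End misspecification.

(* Main.v *)
Require Import Defs.
From HB Require Import structures.
From mathcomp Require Import all_boot all_order all_algebra.
From mathcomp Require Import all_classical all_reals all_analysis.
From mathcomp Require Import measurable_realfun.
From mathcomp Require Import ring lra.

Set Implicit Arguments.
Unset Strict Implicit.
Unset Printing Implicit Defensive.

Import Order.TTheory GRing.Theory Num.Theory.
Import numFieldNormedType.Exports.

Local Open Scope classical_set_scope.
Local Open Scope ring_scope.

(* Write g = p / p*. The posterior mass of a set S is the ratio of
   f_n(S) = int_S prod_(i<n) g(X_i) dPi to f_n of the whole model.

   The denominator is at least exp(-2 n eps^2) Pi(B(eps)) / 2 outside an event of
   probability 2 / (n eps^2): by Chebyshev each P in B(eps) has a likelihood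
   ratio above exp(-2 n eps^2) outside an event of probability 1 / (n eps^2), and
   one averages over P.

   The numerator is treated without tests. On a convex set of densities, the
   functions a |-> P0 g^a are convex and depend concavely on g, so a
   one-dimensional minimax argument gives, for densities truncated at K, one
   exponent a in (0, 1] with P0 min(g, K)^a <= exp(-eps^2 / 16) on the whole set.
   Conditioning on the past, E h^a decays geometrically for every finite mixture
   h of the products prod_i min(g(X_i), K), and f_n is reached from such finite
   mixtures by Maurey's argument and K -> oo. Since min(1, y) <= y^a and the
   posterior mass is at most 1, this bounds the expected posterior mass of each
   piece of a cover of an annulus, and one sums over pieces and annuli. *)

(** * Convexity of powers *)

(** The pieces of a cover are closed only under finite mixtures, whereas [f_n] over a piece is an
    integral against the prior, and products of densities do not form a convex class. This is why
    finite mixtures of products come in: in these, the past of each component acts as a weight. A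
    piece may also have a non-measurable trace on the model; a measurable hull stands in for it,
    while the sampled points are taken from the trace itself.

    The exponent at which P0 g^a is small varies with g, and the minimax point may be 0, where
    nothing decays. Truncation at K lets exponents be shifted slightly at a controlled price, and
    provides the boundedness used in Maurey's argument. The exponent then depends on K, but the cap
    at 1 eliminates it before K grows, and the rate does not involve K.

    The constant 16: the covering condition gives eps^2 / 4; the level eps^2 / 8 is strictly below
    it and is therefore reached by an actual exponent; half of that is given up to the
    truncation. *)

Section powR_convexity.
Context {R : realType}.
Implicit Types (y z t a b : R).

Lemma expR_ge_tangent (m x : R) : expR m * (1 + x - m) <= expR x.
Proof.
rewrite -[in leRHS](subrK m x) expRD mulrC ler_wpM2r ?expR_ge0//.
by rewrite (le_trans _ (expR_ge1Dx _))// addrA.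
Qed.

Lemma expR_convex t a b : 0 <= t <= 1 ->
  expR (t * a + (1 - t) * b) <= t * expR a + (1 - t) * expR b.
Proof.
move=> /andP[t0 t1]; set m := t * a + (1 - t) * b.
have ha := ler_wpM2l t0 (expR_ge_tangent m a).
have hb : (1 - t) * (expR m * (1 + b - m)) <= (1 - t) * expR b.
  by rewrite ler_wpM2l ?subr_ge0// expR_ge_tangent.
apply: le_trans (lerD ha hb); rewrite le_eqVlt; apply/orP; left; apply/eqP.
by rewrite /m; ring.
Qed.

Lemma powR_convex_exponent y t a b : 0 <= y -> 0 < a -> 0 < b -> 0 <= t <= 1 ->
  y `^ (t * a + (1 - t) * b) <= t * y `^ a + (1 - t) * y `^ b.
Proof.
(* The power 0^0 equals 1, so at y = 0 the mixed exponent has to be non-zero. *)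
move=> y0 a0 b0 t01; have [->|yn0] := eqVneq y 0.
  have c0 : t * a + (1 - t) * b != 0.
    case/andP: t01 => t0 t1; rewrite gt_eqF//.
    have [->|tn0] := eqVneq t 0; first by rewrite mul0r subr0 mul1r add0r.
    by rewrite ltr_wpDr ?mulr_ge0 ?subr_ge0 ?(ltW b0)// mulr_gt0// lt_def tn0.
  by rewrite (powR0 c0) (powR0 (lt0r_neq0 a0)) (powR0 (lt0r_neq0 b0)) !mulr0 addr0.
rewrite /powR (negbTE yn0) (le_trans _ (expR_convex _ _ t01))//.
by rewrite ler_expR mulrDl !mulrA.
Qed.

(** Bernoulli's inequality, read off the chord of exp between 0 and ln y. *)
Lemma powR_le_tangent y a : 0 <= y -> 0 < a <= 1 -> y `^ a <= 1 + a * (y - 1).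
Proof.
move=> y0 /andP[a0 a1]; have [->|yn0] := eqVneq y 0.
  by rewrite powR0 ?gt_eqF//; lra.
have y_gt0 : 0 < y by rewrite lt_def yn0.
have := @expR_convex a (ln y) 0; rewrite mulr0 addr0 expR0 mulr1 lnK//.
rewrite /powR (negbTE yn0) => /(_ _)/le_trans; apply; first by rewrite ltW.
by lra.
Qed.

(** The tangent at the mean m lies above the power, and its linear part cancels in the mixture. It
    is written relative to m, so m = 0 is treated apart. *)
Lemma powR_concave y z t a : 0 <= y -> 0 <= z -> 0 < a <= 1 -> 0 <= t <= 1 ->
  t * y `^ a + (1 - t) * z `^ a <= (t * y + (1 - t) * z) `^ a.
Proof.
move=> y0 z0 a01 /andP[t0 t1]; set m := t * y + (1 - t) * z.
have t1' : 0 <= 1 - t by rewrite subr_ge0.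
have m0 : 0 <= m by rewrite addr_ge0 ?mulr_ge0.
have a_neq0 : a != 0 by case/andP: a01 => a0 _; rewrite gt_eqF.
have [m_eq0|mn0] := eqVneq m 0.
  have /andP[/eqP ty /eqP tz] : (t * y == 0) && ((1 - t) * z == 0).
    by rewrite -paddr_eq0 ?mulr_ge0//; apply/eqP.
  rewrite m_eq0 powR0// le_eqVlt; apply/orP; left.
  have -> : t * y `^ a = 0.
    move/eqP: ty; rewrite mulf_eq0 => /orP[/eqP->|/eqP->]; first by rewrite mul0r.
    by rewrite powR0// mulr0.
  move/eqP: tz; rewrite mulf_eq0 => /orP[/eqP->|/eqP->].
    by rewrite mul0r addr0.
  by rewrite powR0// mulr0 addr0.
have tangent x : 0 <= x -> x `^ a <= m `^ a * (1 + a * (x / m - 1)).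
  move=> x0; rewrite -{1}(mulfVK mn0 x) mulrC powRM ?divr_ge0// ler_wpM2l ?powR_ge0//.
  by rewrite powR_le_tangent// divr_ge0.
apply: le_trans (lerD (ler_wpM2l t0 (tangent _ y0)) (ler_wpM2l t1' (tangent _ z0))) _.
have mm : t * (y / m) + (1 - t) * (z / m) = 1.
  by rewrite !mulrA -mulrDl divff.
rewrite le_eqVlt; apply/orP; left; apply/eqP.
transitivity (m `^ a * (1 + a * (t * (y / m) + (1 - t) * (z / m) - 1))).
  by ring.
by rewrite mm subrr mulr0 addr0 mulr1.
Qed.

Lemma powR_le1D y a : 0 <= y -> 0 < a <= 1 -> y `^ a <= 1 + y.
Proof.
move=> y0 a01; apply: le_trans (powR_le_tangent y0 a01) _.
case/andP: a01 => a0 a1; have := mulr_ge0 y0 (ltW a0).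
have : 0 <= y * (1 - a) by rewrite mulr_ge0// subr_ge0.
by lra.
Qed.

Lemma min1_le_powR y a : 0 <= y -> 0 < a <= 1 -> Num.min 1 y <= y `^ a.
Proof.
move=> y0 a01; have [y1|y1] := leP 1 y.
  by rewrite -{1}(powRr0 y) ler_powR//; case/andP: a01 => /ltW.
have [->|yn0] := eqVneq y 0; first by rewrite powR_ge0.
rewrite -{1}(powRr1 y0) ger_powR//; last by case/andP: a01.
by rewrite lt_def yn0 y0 ltW.
Qed.

(* The slope is the supremum of the slopes of the chords ending at [b]. *)
Lemma convex_subgradient (u : R -> R) b : 0 < b < 1 ->
  (forall t x y, 0 < x < 1 -> 0 < y < 1 -> 0 <= t <= 1 ->
    u (t * x + (1 - t) * y) <= t * u x + (1 - t) * u y) ->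
  exists s, forall x, 0 < x < 1 -> u b + s * (x - b) <= u x.
Proof.
move=> /andP[b0 b1] cvx.
pose S := [set r | exists2 x, 0 < x < b & r = (u b - u x) / (b - x)].
have three x y : 0 < x < b -> b < y < 1 ->
    (u b - u x) / (b - x) <= (u y - u b) / (y - b).
  move=> /andP[x0 xb] /andP[lby y1].
  have xy : 0 < y - x by rewrite subr_gt0 (lt_trans xb).
  have bx : 0 < b - x by rewrite subr_gt0.
  have yb : 0 < y - b by rewrite subr_gt0.
  rewrite ler_pdivrMr// mulrAC ler_pdivlMr//.
  have := cvx ((y - b) / (y - x)) x y.
  have -> : (y - b) / (y - x) * x + (1 - (y - b) / (y - x)) * y = b.
    by field; rewrite gt_eqF.
  have x01 : 0 < x < 1 by rewrite x0 (lt_trans xb).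
  have y01 : 0 < y < 1 by rewrite y1 andbT (lt_trans b0).
  have t01 : 0 <= (y - b) / (y - x) <= 1.
    by rewrite divr_ge0 ?(ltW yb) ?(ltW xy)//= ler_pdivrMr// mul1r; lra.
  move=> /(_ x01 y01 t01); rewrite -(ler_pM2r xy).
  have -> : ((y - b) / (y - x) * u x + (1 - (y - b) / (y - x)) * u y) * (y - x) =
    (y - b) * u x + (b - x) * u y by field; rewrite gt_eqF.
  by lra.
have S0 : S !=set0 by exists ((u b - u (b / 2)) / (b - b / 2)); exists (b / 2) => //; lra.
have mid : b < (b + 1) / 2 < 1 by lra.
have ubS : has_ubound S.
  by exists ((u ((b + 1) / 2) - u b) / ((b + 1) / 2 - b)) => _ [x xb ->]; exact: three.
exists (sup S) => x /andP[x0 x1]; have [xb|bx|->] := ltgtP x b.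
- have : (u b - u x) / (b - x) <= sup S.
    by apply: ub_le_sup => //; exists x; rewrite ?x0.
  by rewrite ler_pdivrMr ?subr_gt0//; lra.
- have : sup S <= (u x - u b) / (x - b).
    by apply: ge_sup => // _ [y yb ->]; apply: three => //; rewrite bx.
  by rewrite ler_pdivlMr ?subr_gt0//; lra.
- by rewrite subrr mulr0 addr0.
Qed.

(* The mixture balances the slopes at [b] of supporting lines of [u] and [v]. *)
Lemma convex_pair_mixture (u v : R -> R) c (a b b' : R) :
  (forall t x y, 0 < x < 1 -> 0 < y < 1 -> 0 <= t <= 1 ->
    u (t * x + (1 - t) * y) <= t * u x + (1 - t) * u y) ->
  (forall t x y, 0 < x < 1 -> 0 < y < 1 -> 0 <= t <= 1 ->
    v (t * x + (1 - t) * y) <= t * v x + (1 - t) * v y) ->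
  0 < a -> a < b -> b < b' -> b' < 1 -> u a < c -> v b' < c ->
  c <= u b -> c <= v b ->
  exists2 t : R, 0 <= t <= 1 & forall e, 0 < e < 1 -> c <= t * u e + (1 - t) * v e.
Proof.
move=> ucvx vcvx a0 ab bb' b'1 ua vb' ub vb.
have b01 : 0 < b < 1 by lra.
have [s hs] := convex_subgradient b01 ucvx.
have [r hr] := convex_subgradient b01 vcvx.
(* [u] is below c at a < b and [v] is below c at b' > b, while both are at least c at b; the two
   slopes thus have strictly opposite signs. *)
have s0 : 0 < s.
  rewrite ltNge; apply/negP => s0.
  have /hs : 0 < a < 1 by lra.
  have : 0 <= s * (a - b) by rewrite mulr_le0// subr_le0 ltW.
  by lra.
have r0 : r < 0.
  rewrite ltNge; apply/negP => r0.
  have /hr : 0 < b' < 1 by lra.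
  have : 0 <= r * (b' - b) by rewrite mulr_ge0// subr_ge0 ltW.
  by lra.
pose t := - r / (s - r).
have sr : 0 < s - r by lra.
have t01 : 0 <= t <= 1.
  by rewrite /t divr_ge0 ?(ltW sr) ?oppr_ge0 ?(ltW r0)//= ler_pdivrMr// mul1r; lra.
have tsr : t * s + (1 - t) * r = 0 by rewrite /t; field; rewrite gt_eqF.
exists t => // e e01; clearbody t.
case/andP: (t01) => t0 t1; have t1' : 0 <= 1 - t by rewrite subr_ge0.
apply: le_trans (lerD (ler_wpM2l t0 (hs e e01)) (ler_wpM2l t1' (hr e e01))).
have := lerD (ler_wpM2l t0 ub) (ler_wpM2l t1' vb).
have : (t * s + (1 - t) * r) * (e - b) = 0 by rewrite tsr mul0r.
by lra.
Qed.

(* One-dimensional Helly argument: the supremum of the points lying strictly to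
   the left of some sublevel set is adherent to every sublevel set. *)
Lemma near_common_point (I : Type) (u : I -> R -> R) (c tau : R) : 0 < tau ->
  (forall i, exists2 a : R, 0 < a < 1 & u i a < c) ->
  (forall i j (a b b' : R), 0 < a -> a < b -> b < b' -> b' < 1 ->
    u i a < c -> u j b' < c -> c <= u i b -> c <= u j b -> False) ->
  exists2 e : R, 0 <= e <= 1 &
    forall i, exists a : R, [/\ 0 < a < 1, u i a < c & `|a - e| < tau].
Proof.
move=> tau0 rate nsep.
(* The point 0 keeps [S] non-empty and its supremum non-negative. *)
pose S := [set b : R | b = 0 \/ (0 < b /\ exists j b',
  [/\ b < b' < 1, u j b' < c & c <= u j b])].
have S0 : S 0 by left.
have ubS : ubound S 1.
  by move=> b [->//|[_ [j [b' [/andP[bb' b'1] _ _]]]]]; rewrite ltW// (lt_trans bb').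
have hS : has_sup S by split; [exists 0|exists 1].
have supS b : S b -> b <= sup S by apply: ub_le_sup; exists 1.
exists (sup S).
  by rewrite supS//=; apply: ge_sup => //; exists 0.
move=> i; have [a a01 ua] := rate i.
have t20 : 0 < tau / 2 by rewrite divr_gt0.
have [alo|ahi] := ltrP a (sup S - tau / 2).
(* Here a is too far left. A point b of [S] close to the supremum has a sublevel point of some j to
   its right; if b were outside the sublevel set of i, the pair i, j would be separated at b. *)
- have [b [b0|[b0 [j [b' [/andP[bb' b'1] uj' uj]]]]] bS] := sup_adherent t20 hS.
    by exfalso; case/andP: a01; lra.
  exists b; split.
  + by rewrite b0 (lt_trans bb').
  + rewrite ltNge; apply/negP => ub.
    by apply: (nsep i j a b b') => //; lra.
  + have bsup : b <= sup S.
      by apply: supS; right; split => //; exists j, b'; rewrite bb'.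
    by rewrite ltr_norml; lra.
(* If a is too far right, the point just beyond the supremum lies in the sublevel set of i, since
   otherwise it would belong to [S]. *)
- have [hi|lo] := ltrP (sup S + tau / 2) a; last first.
    by exists a; split => //; rewrite ltr_norml; lra.
  have e0 := supS 0 S0.
  exists (sup S + tau / 2); split; last by rewrite addrAC subrr add0r gtr0_norm; lra.
    by case/andP: a01; lra.
  rewrite ltNge; apply/negP => ub.
  have /supS : S (sup S + tau / 2).
    right; split; first by lra.
    by exists i, a; split => //; case/andP: a01 => _ ->; rewrite hi.
  by lra.
Qed.

End powR_convexity.

(** * A common exponent on a convex class *)

Section common_exponent.
Context {R : realType} d (T : measurableType d) (P : probability T R).
Variable (G : set (T -> R)) (c : R).
Hypothesis G_meas : forall g, G g -> measurable_fun setT g.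
Hypothesis G_ge0 : forall g x, G g -> 0 <= g x.
Hypothesis G_int : forall g, G g -> P.-integrable setT (EFin \o g).
Hypothesis G_convex : forall g h (t : R), G g -> G h -> 0 <= t <= 1 ->
  G (fun x => t * g x + (1 - t) * h x).
Hypothesis G_rate : forall g, G g ->
  exists2 a : R, 0 < a < 1 & \int[P]_x (g x `^ a) < c.

Local Notation u g a := (\int[P]_x (g x `^ a))%R.

Lemma powR_integrable (g : T -> R) (a : R) : measurable_fun setT g ->
  (forall x, 0 <= g x) -> P.-integrable setT (EFin \o g) -> 0 < a <= 1 ->
  P.-integrable setT (fun x => (g x `^ a)%:E).
Proof.
move=> mg g0 ig a01.
apply: (@le_integrable _ _ _ _ _ measurableT _ (EFin \o (fun x => 1 + g x)%R)).
- apply/measurable_EFinP.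
  exact: (@measurableT_comp _ _ _ _ _ _ (@powR R ^~ a) _ g).
- move=> x _; rewrite lee_fin !ger0_norm ?powR_ge0 ?addr_ge0//.
  exact: powR_le1D.
- rewrite (_ : EFin \o _ = (fun x => (EFin \o cst 1%R) x + (EFin \o g) x)%E)//.
  by apply: integrableD => //; exact: finite_measure_integrable_cst.
Qed.

Let u_int g (a : R) : G g -> 0 < a <= 1 -> P.-integrable setT (fun x => (g x `^ a)%:E).
Proof.
move=> Gg a01; apply: powR_integrable => //; [exact: G_meas| |exact: G_int].
by move=> x; exact: G_ge0.
Qed.

Let lt01_le1 (a : R) : 0 < a < 1 -> 0 < a <= 1.
Proof. by case/andP=> -> /ltW. Qed.

Let u_convex g (t a b : R) : G g -> 0 < a < 1 -> 0 < b < 1 -> 0 <= t <= 1 ->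
  u g (t * a + (1 - t) * b) <= t * u g a + (1 - t) * u g b.
Proof.
move=> Gg a01 b01 t01.
have c01 : 0 < t * a + (1 - t) * b <= 1.
  case/andP: a01 b01 t01 => a0 a1 /andP[b0 b1] /andP[t0 t1].
  have [->|tn0] := eqVneq t 0; first by rewrite mul0r subr0 mul1r add0r b0 ltW.
  have tp : 0 < t by rewrite lt_def tn0.
  have h1 := mulr_gt0 tp a0.
  have h2 : 0 <= (1 - t) * b by rewrite mulr_ge0 ?subr_ge0// ltW.
  have h3 : t * a <= t by rewrite ler_piMr// ltW.
  have h4 : (1 - t) * b <= 1 - t by rewrite ler_piMr ?subr_ge0// ltW.
  by lra.
have ia := u_int Gg (lt01_le1 a01); have ib := u_int Gg (lt01_le1 b01).
have ita : P.-integrable setT (fun x => (t * g x `^ a)%:E).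
  by under eq_fun do rewrite EFinM; exact: integrableZl.
have itb : P.-integrable setT (fun x => ((1 - t) * g x `^ b)%:E).
  by under eq_fun do rewrite EFinM; exact: integrableZl.
rewrite -!RintegralZl// -RintegralD//.
apply: le_Rintegral => //; first exact: u_int.
  by apply: (@integrableD _ _ _ _ _ measurableT _ _ ita itb).
move=> x _; apply: powR_convex_exponent => //; first exact: G_ge0.
- by case/andP: a01.
- by case/andP: b01.
Qed.

Let u_concave g h (t a : R) : G g -> G h -> 0 < a < 1 -> 0 <= t <= 1 ->
  t * u g a + (1 - t) * u h a <= u (fun x => t * g x + (1 - t) * h x) a.
Proof.
move=> Gg Gh /lt01_le1 a01 t01.
have ig := u_int Gg a01; have ih := u_int Gh a01.
have itg : P.-integrable setT (fun x => (t * g x `^ a)%:E).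
  by under eq_fun do rewrite EFinM; exact: integrableZl.
have ith : P.-integrable setT (fun x => ((1 - t) * h x `^ a)%:E).
  by under eq_fun do rewrite EFinM; exact: integrableZl.
rewrite -!RintegralZl// -RintegralD//.
apply: le_Rintegral => //.
- by apply: (@integrableD _ _ _ _ _ measurableT _ _ itg ith).
- by apply: u_int => //; exact: G_convex.
- by move=> x _; apply: powR_concave => //; exact: G_ge0.
Qed.

(** For a separated pair, some mixture of g and h would have all its moments at least c, by
    concavity in the function; but this mixture belongs to [G] and so has a moment below c. *)
Let u_not_separated g h (a b b' : R) : G g -> G h ->
  0 < a -> a < b -> b < b' -> b' < 1 -> u g a < c -> u h b' < c ->
  c <= u g b -> c <= u h b -> False.
Proof.
move=> Gg Gh a0 ab bb' b'1 uga uhb' ugb uhb.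
have [t t01 ht] := @convex_pair_mixture _ (fun a => u g a) (fun a => u h a) c a b b'
  (fun t x y x0 y0 => @u_convex g t x y Gg x0 y0)
  (fun t x y x0 y0 => @u_convex h t x y Gh x0 y0) a0 ab bb' b'1 uga uhb' ugb uhb.
have [e e01] := G_rate (G_convex Gg Gh t01).
by apply/negP; rewrite -leNgt; apply: le_trans (ht e e01) (u_concave Gg Gh e01 t01).
Qed.

(** Each member keeps its own exponent, merely close to e: e arises as a supremum and may be an end
    of the unit interval. *)
Lemma common_exponent (tau : R) : 0 < tau -> exists2 e : R, 0 <= e <= 1 &
  forall g, G g -> exists a : R, [/\ 0 < a < 1, u g a < c & `|a - e| < tau].
Proof.
move=> tau0.
have [e e01 he] := @near_common_point _ {g | G g} (fun g a => u (sval g) a) c tau tau0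
  (fun g => G_rate (svalP g))
  (fun g h a b b' => u_not_separated (svalP g) (svalP h)).
by exists e => // g Gg; exact: (he (exist _ g Gg)).
Qed.

(** Raising the exponent of a member from its own b to the common a costs a factor at most K^(a - b)
    on functions bounded by K. *)
Lemma truncated_common_exponent (K s : R) : 1 <= K -> 0 < s ->
  exists2 a : R, 0 < a <= 1 & forall g, G g ->
    \int[P]_x (Num.min (g x) K `^ a) <= c * expR s.
Proof.
move=> K1 s0; have K0 : 0 < K by exact: lt_le_trans K1.
have lK0 : 0 <= ln K by rewrite ln_ge0.
(* This makes 2 * tau * ln K at most s; the 1 keeps the denominator positive when K = 1. *)
pose tau := s / (2 * (ln K + 1)).
have tau0 : 0 < tau by rewrite divr_gt0// mulr_gt0// ltr_wpDl.
have [e /andP[e0 e1] he] := common_exponent tau0.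
(* Adding tau puts the exponent above every admissible b and makes it positive even if e = 0. *)
have a01 : 0 < Num.min 1 (e + tau) <= 1.
  by rewrite lt_min ltr01 ge_min lexx/= andbT ltr_wpDl.
exists (Num.min 1 (e + tau)) => // g Gg; set a := Num.min _ _ in a01 *.
have [b [/andP[b0 b1] ugb]] := he g Gg; rewrite ltr_norml => /andP[be1 be2].
have ba : b <= a by rewrite le_min (ltW b1)/=; lra.
have ab : a - b <= 2 * tau.
  have : a <= e + tau by rewrite /a ge_min lexx orbT.
  by lra.
have Kab : K `^ (a - b) <= expR s.
  rewrite /powR gt_eqF// ler_expR.
  apply: (@le_trans _ _ (2 * tau * ln K)); first by rewrite ler_wpM2r.
  rewrite /tau (_ : _ * _ = s * (ln K / (ln K + 1))); last first.
    by field; rewrite gt_eqF// ltr_wpDl.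
  rewrite ler_piMr ?(ltW s0)// ler_pdivrMr ?mul1r; first by lra.
  by rewrite ltr_wpDl.
have b01 : 0 < b <= 1 by rewrite b0 ltW.
have mK : measurable_fun setT (fun x => Num.min (g x) K).
  by apply: measurable_minr => //; exact: G_meas.
have ib : P.-integrable setT (fun x => (expR s * g x `^ b)%:E).
  by under eq_fun do rewrite EFinM; apply: integrableZl => //; exact: u_int.
apply: (@le_trans _ _ (\int[P]_x (expR s * g x `^ b))); last first.
  rewrite RintegralZl//; last exact: u_int.
  by rewrite mulrC ler_wpM2r ?expR_ge0// ltW.
apply: le_Rintegral => //.
- apply: powR_integrable => //.
    by move=> x; rewrite le_min G_ge0//= ltW.
  apply: (@le_integrable _ _ _ _ _ measurableT _ _ _ _ (G_int Gg)).
    exact/measurable_EFinP.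
  move=> x _; rewrite lee_fin !ger0_norm ?G_ge0//; last by rewrite le_min G_ge0//= ltW.
  by rewrite ge_min lexx.
- move=> x _; set m := Num.min _ _.
  have m0 : 0 <= m by rewrite le_min G_ge0//= ltW.
  have -> : m `^ a = m `^ (a - b) * m `^ b.
    by rewrite -powRD ?subrK//; apply/implyP; rewrite gt_eqF//; case/andP: a01.
  apply: ler_pM; rewrite ?powR_ge0//.
    apply: le_trans Kab; apply: ge0_ler_powR; rewrite ?subr_ge0 ?nnegrE//.
      exact: ltW.
    by rewrite ge_min lexx orbT.
  have mg : m <= g x by rewrite ge_min lexx.
  by rewrite ge0_ler_powR ?nnegrE ?(ltW b0)//; exact: G_ge0.
Qed.

(** Binary convexity is iterated after normalising by the partial weight W. If W vanishes, all
    earlier weights are 0 and the last member serves alone. *)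
Lemma finite_mixture (m : nat) (w : nat -> R) (g : nat -> T -> R) :
  (forall j, 0 <= w j) -> (forall j, G (g j)) -> 0 < \sum_(j < m) w j ->
  exists2 h, G h & forall x, \sum_(j < m) w j * g j x = (\sum_(j < m) w j) * h x.
Proof.
move=> w0 Gg; elim: m => [|m ih]; first by rewrite big_ord0 ltxx.
rewrite big_ord_recr/=; set W := \sum_(j < m) w j => Ww.
have : 0 <= W by rewrite sumr_ge0.
rewrite le_eqVlt => /predU1P[W0|Wgt0].
  exists (g m) => // x; rewrite !big_ord_recr/= -W0 add0r big1 ?add0r// => j _.
  have : \sum_(j < m) w j == 0 by rewrite -/W -W0.
  rewrite psumr_eq0// => /allP/(_ j); rewrite mem_index_enum => /(_ isT)/eqP ->.
  by rewrite mul0r.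
have [h Gh hE] := ih Wgt0.
exists (fun x => (W / (W + w m)) * h x + (1 - W / (W + w m)) * g m x).
  apply: G_convex => //.
  by rewrite divr_ge0 ?(ltW Wgt0) ?(ltW Ww)//= ler_pdivrMr// mul1r lerDl.
move=> x; rewrite !big_ord_recr/= hE -/W; field.
by rewrite gt_eqF.
Qed.

End common_exponent.

(** * Conditioning on the past *)

Section independence.
Context {R : realType} dX (X : measurableType dX) dO (Omega : measurableType dO).
Variables (Pr : probability Omega R) (P0 : probability X R).
Variable Xs : nat -> {mfun Omega >-> X}.
Hypothesis Xs_iid : iid Pr P0 Xs.

Definition past_sets (n : nat) : set (set Omega) :=
  [set C | exists2 A : nat -> set X, forall i, measurable (A i) &
    C = \bigcap_(i in [set` iota 0 n]) (Xs i @^-1` A i)].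

(** [Omega] with the sigma-field of the first n observations, as a type of its own: the pair of past
    and X_n then lives in a product space where Tonelli applies. *)
Definition past (n : nat) := g_sigma_algebraType (past_sets n).
HB.instance Definition _ n := Measurable.on (past n).

Let measurable_preimage i (A : set X) : measurable A -> measurable (Xs i @^-1` A).
Proof. by move=> mA; rewrite -[X in measurable X]setTI; exact: measurable_funP. Qed.

Lemma past_sets_setI n : setI_closed (past_sets n).
Proof.
move=> _ _ [A mA ->] [B mB ->]; exists (fun i => A i `&` B i).
  by move=> i; exact: measurableI.
by apply/seteqP; split=> [w [Aw Bw] i /= si|w ABw];
  [split; [exact: Aw|exact: Bw]|split=> i si; case: (ABw i si)].
Qed.

Lemma past_measurable n (C : set Omega) :
  (measurable : set (set (past n))) C -> measurable C.
Proof.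
move=> mC; apply: mC; split; first exact: sigma_algebra_measurable.
move=> _ [A mA ->]; apply: fin_bigcap_measurable; first exact: finite_seq.
by move=> i _; exact: measurable_preimage.
Qed.

Lemma measurable_from_past n : measurable_fun setT (id : Omega -> past n).
Proof. by move=> _ B mB; rewrite setTI; exact: past_measurable mB. Qed.

Lemma measurable_on_past n dY (Y : measurableType dY) (f : past n -> Y) :
  measurable_fun setT f -> measurable_fun (setT : set Omega) (f : Omega -> Y).
Proof.
by move=> mf _ B mB; have := mf measurableT B mB; rewrite !setTI; exact: past_measurable.
Qed.

Lemma measurable_past i n : (i < n)%N -> measurable_fun setT (Xs i : past n -> X).
Proof.
move=> i_n _ B mB; rewrite setTI; apply: sub_sigma_algebra.
exists (fun j => if j == i then B else setT); first by move=> j; case: eqP.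
apply/seteqP; split => [w /= Bw j _|w /= /(_ i)].
  by case: eqP => // ->.
by rewrite /= mem_iota add0n i_n eqxx; apply.
Qed.

(** Dynkin's argument: the events C that satisfy the product formula form a Dynkin system, and it
    contains the pi-system [past_sets]. *)
Lemma past_independent n (C : set Omega) (B : set X) :
  (measurable : set (set (past n))) C -> measurable B ->
  Pr (C `&` Xs n @^-1` B) = (Pr C * P0 B)%E.
Proof.
move=> mC mB; set D := Xs n @^-1` B.
have mD : measurable D by exact: measurable_preimage.
have PD : Pr D = P0 B by case: Xs_iid => /(_ n B mB).
rewrite -PD.
pose good : set (set Omega) := [set C | measurable C /\ Pr (C `&` D) = (Pr C * Pr D)%E].
suff /(_ C mC)[] : <<s past_sets n >> `<=` good by [].
rewrite -(setI_closed_g_dynkin_g_sigma_algebra (@past_sets_setI n)).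
apply: smallest_sub.
  split; rewrite /good/=.
  - by split; [exact: measurableT|rewrite setTI probability_setT mul1e].
  - move=> E [mE PE]; split; first exact: measurableC.
    rewrite setIC -setDE measureD//; last first.
      by rewrite (le_lt_trans (probability_le1 _ _))// ltry.
    rewrite (setIC D E); transitivity (Pr D - Pr E * Pr D)%E.
      by congr (_ - _)%E; exact: PE.
    rewrite probability_setC// muleBl ?mul1e//.
    by rewrite fin_num_measure.
  - move=> F tF gF; split; first by apply: bigcupT_measurable => i; case: (gF i).
    rewrite setI_bigcupl measure_bigcup//=; last 2 first.
    + by move=> i _; apply: measurableI => //; case: (gF i).
    + exact: trivIset_setIr.
    rewrite measure_bigcup//=; last by move=> i _; case: (gF i).
    have PDfin : Pr D = (fine (Pr D))%:E by rewrite fineK// fin_num_measure.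
    rewrite muleC [in RHS]PDfin -nneseriesZl//.
    by apply: eq_eseriesr => i _; rewrite muleC -PDfin; case: (gF i).
move=> _ [A mA ->]; split.
  apply: fin_bigcap_measurable; first exact: finite_seq.
  by move=> i _; exact: measurable_preimage.
(* A rectangle in the past intersected with [D] is a rectangle over n + 1 indices, to which the
   product formula of [iid] applies. *)
pose A' i := if i == n then B else A i.
have mA' i : measurable (A' i) by rewrite /A'; case: eqP.
have A'A i : i \in iota 0 n -> A' i = A i.
  by rewrite mem_iota add0n /A'/= => i_n; rewrite ltn_eqF.
have [_ ind] := Xs_iid.
have -> : \bigcap_(i in [set` iota 0 n]) (Xs i @^-1` A i) `&` D =
    \bigcap_(i in [set` iota 0 n.+1]) (Xs i @^-1` A' i).
  rewrite -addn1 iotaD add0n/=; apply/seteqP; split.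
  - move=> w [Aw Dw] i /=; rewrite mem_cat mem_seq1 => /orP[si|/eqP->].
      by rewrite A'A//; exact: Aw.
    by rewrite /A' eqxx.
  - move=> w Aw; split=> [i /= si|].
      by rewrite -A'A//; apply: Aw; rewrite /= mem_cat si.
    by have := Aw n; rewrite /= mem_cat mem_seq1 eqxx orbT /A' eqxx => /(_ isT).
rewrite ind ?iota_uniq// ind ?iota_uniq// -addn1 iotaD big_cat/= big_seq1 add0n.
rewrite {2}/A' eqxx; congr (_ * _)%E; rewrite big_seq [RHS]big_seq.
by apply: eq_bigr => i si; rewrite A'A.
Qed.

(** This replaces conditional expectation: the pair of past and X_n has the product law, and Tonelli
    integrates X_n first. *)
Lemma integral_past_present n (h : past n * X -> \bar R) :
  measurable_fun setT h -> (forall z, 0 <= h z)%E ->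
  (\int[Pr]_w h (w, Xs n w) = \int[Pr]_w \int[P0]_y h (w, y))%E.
Proof.
move=> mh h0.
pose J (w : Omega) : past n * X := (w, Xs n w).
have mJ : measurable_fun setT J.
  apply: measurable_fun_pair; first exact: measurable_from_past.
  exact: measurable_funP.
pose Jm : {mfun Omega >-> (past n * X)%type} := HB.pack J (isMeasurableFun.Build _ _ _ _ J mJ).
pose im : {mfun Omega >-> past n} :=
  HB.pack (id : Omega -> past n) (isMeasurableFun.Build _ _ _ _ _ (@measurable_from_past n)).
transitivity (\int[distribution Pr Jm]_z h z)%E.
  by rewrite ge0_integral_distribution.
transitivity (\int[distribution Pr im \x P0]_z h z)%E.
  apply: eq_measure_integral => A mA _; apply/esym.
  apply: product_measure_unique => // C B mC mB.
  rewrite /distribution /pushforward/=.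
  rewrite -(past_independent mC mB); congr (Pr _).
rewrite fubini_tonelli1// /fubini_F ge0_integral_distribution//.
- exact: measurable_fun_fubini_tonelli_F.
- by move=> w; apply: integral_ge0 => y _.
Qed.

End independence.

(** The cross term vanishes since Y is centred. Both the variance of an i.i.d. sum and Maurey's
    selection rest on this. *)
Lemma integral_sqr_shift_le {R : realType} d (T : measurableType d)
    (P : probability T R) (Y : T -> R) (v s : R) :
  measurable_fun setT Y -> P.-integrable setT (EFin \o Y) ->
  (\int[P]_x (Y x)%:E = 0)%E -> (\int[P]_x (Y x ^+ 2)%:E <= v%:E)%E ->
  (\int[P]_x ((s + Y x) ^+ 2)%:E <= (s ^+ 2)%:E + v%:E)%E.
Proof.
move=> mY iY EY VY.
have mY2 : measurable_fun setT (fun x => Y x ^+ 2) by exact: measurable_funX.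
have iY2 : P.-integrable setT (fun x => (Y x ^+ 2)%:E).
  apply/integrableP; split; first exact/measurable_EFinP.
  under eq_integral do rewrite gee0_abs ?lee_fin ?sqr_ge0//.
  by rewrite (le_lt_trans VY)// ltry.
have E y : ((s + Y y) ^+ 2)%:E =
    ((s ^+ 2)%:E + ((2 * s)%:E * (Y y)%:E + (Y y ^+ 2)%:E))%E.
  by rewrite sqrrD -EFinM -!EFinD; congr (_%:E); ring.
under eq_integral do rewrite E.
have iZ : P.-integrable setT (fun y => ((2 * s)%:E * (Y y)%:E)%E).
  exact: integrableZl.
rewrite integralD//; last 2 first.
- exact: finite_measure_integrable_cst.
- exact: integrableD.
rewrite integralD// integralZl// EY mule0 add0e.
by rewrite integral_cst//= probability_setT mule1 leeD2l.
Qed.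

(** * Recursions over the sample size: powers of mixtures and second moments *)

Section iid_recursions.
Context {R : realType} dX (X : measurableType dX) dO (Omega : measurableType dO).
Variables (Pr : probability Omega R) (P0 : probability X R).
Variable Xs : nat -> {mfun Omega >-> X}.
Hypothesis Xs_iid : iid Pr P0 Xs.

Lemma measurable_past_comp (f : X -> R) i n : measurable_fun setT f -> (i < n)%N ->
  measurable_fun setT (fun w : past Xs n => f (Xs i w)).
Proof. by move=> mf i_n; apply: measurableT_comp => //; exact: measurable_past. Qed.

(** Once the past is fixed, w_j times its product over the past is again a non-negative weight, so
    each observation gains a factor c. For this induction the one-step hypothesis ranges over all
    weights. *)
Lemma mixture_power_bound (m : nat) (k : nat -> X -> R) (a c : R) :
  0 < a -> 0 <= c ->
  (forall j, measurable_fun setT (k j)) -> (forall j x, 0 <= k j x) ->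
  (forall w : nat -> R, (forall j, 0 <= w j) ->
    (\int[P0]_x (((\sum_(j < m) w j * k j x) `^ a)%:E) <=
     (c * (\sum_(j < m) w j) `^ a)%:E)%E) ->
  forall (n : nat) (w : nat -> R), (forall j, 0 <= w j) ->
    (\int[Pr]_o (((\sum_(j < m) w j * \prod_(i < n) k j (Xs i o)) `^ a)%:E) <=
     (c ^+ n * (\sum_(j < m) w j) `^ a)%:E)%E.
Proof.
move=> a0 c0 mk k0 step; elim=> [|n ih] w w0.
  under eq_integral do under eq_bigr do rewrite big_ord0 mulr1.
  by rewrite integral_cst//= probability_setT mule1 expr0 mul1r.
pose W j (o : past Xs n) := w j * \prod_(i < n) k j (Xs i o).
have mW j : measurable_fun setT (W j).
  apply: measurable_funM => //; apply: measurable_prod => i _.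
  exact: measurable_past_comp.
have W0 j o : 0 <= W j o by rewrite mulr_ge0// prodr_ge0.
pose h (z : past Xs n * X) := ((\sum_(j < m) W j z.1 * k j z.2) `^ a)%:E.
have mh : measurable_fun setT h.
  apply/measurable_EFinP.
  apply: (@measurableT_comp _ _ _ _ _ _ (@powR R ^~ a)) => //.
  apply: measurable_sum => j; apply: measurable_funM.
    exact: (measurableT_comp (mW j) measurable_fst).
  exact: (measurableT_comp (mk j) measurable_snd).
have h0 z : (0 <= h z)%E by rewrite lee_fin powR_ge0.
have mWO j : measurable_fun setT (W j : Omega -> R).
  exact: measurable_on_past (mW j).
apply: (@le_trans _ _ (\int[Pr]_o h (o, Xs n o))%E).
  rewrite le_eqVlt; apply/orP; left; apply/eqP; apply: eq_integral => o _.
  rewrite /h/=; congr ((_ `^ _)%:E); apply: eq_bigr => j _.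
  by rewrite big_ord_recr/= mulrA.
rewrite (integral_past_present Xs_iid)//.
apply: (@le_trans _ _ (\int[Pr]_o (c%:E * ((\sum_(j < m) W j o) `^ a)%:E))%E).
  apply: ge0_le_integral => //.
  - by move=> o _; exact: integral_ge0.
  - exact: measurable_on_past (measurable_fun_fubini_tonelli_F _ mh h0).
  - apply: emeasurable_funM => //; apply/measurable_EFinP.
    apply: (@measurableT_comp _ _ _ _ _ _ (@powR R ^~ a)) => //.
    exact: measurable_sum.
  - by move=> o _; rewrite -EFinM; apply: (step (W ^~ o)).
rewrite ge0_integralZl_EFin//.
- by rewrite exprS -mulrA EFinM lee_wpmul2l ?lee_fin//; exact: ih.
- by move=> o _; rewrite lee_fin powR_ge0.
- apply/measurable_EFinP.
  apply: (@measurableT_comp _ _ _ _ _ _ (@powR R ^~ a)) => //.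
  exact: measurable_sum.
Qed.

Lemma second_moment_iid_sum (Y : X -> R) (v : R) :
  measurable_fun setT Y -> P0.-integrable setT (EFin \o Y) ->
  (\int[P0]_x (Y x)%:E = 0)%E -> (\int[P0]_x (Y x ^+ 2)%:E <= v%:E)%E ->
  forall n, (\int[Pr]_o ((\sum_(i < n) Y (Xs i o)) ^+ 2)%:E <= (n%:R * v)%:E)%E.
Proof.
move=> mY iY EY VY; elim=> [|n ih].
  under eq_integral do rewrite big_ord0 expr0n/=.
  by rewrite integral0 mul0r.
have v0 : 0 <= v.
  rewrite -lee_fin; apply: le_trans VY; apply: integral_ge0 => x _.
  by rewrite lee_fin sqr_ge0.
pose S (o : past Xs n) := \sum_(i < n) Y (Xs i o).
have mS : measurable_fun setT S.
  by apply: measurable_sum => i; exact: measurable_past_comp.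
pose h (z : past Xs n * X) := ((S z.1 + Y z.2) ^+ 2)%:E.
have mh : measurable_fun setT h.
  apply/measurable_EFinP; apply: measurable_funX; apply: measurable_funD.
    exact: (measurableT_comp mS measurable_fst).
  exact: (measurableT_comp mY measurable_snd).
have h0 z : (0 <= h z)%E by rewrite lee_fin sqr_ge0.
have mSO : measurable_fun setT (S : Omega -> R).
  exact: measurable_on_past mS.
have mS2 : measurable_fun setT (fun o : Omega => (S o ^+ 2)%:E).
  by apply/measurable_EFinP; exact: measurable_funX.
apply: (@le_trans _ _ (\int[Pr]_o h (o, Xs n o))%E).
  rewrite le_eqVlt; apply/orP; left; apply/eqP; apply: eq_integral => o _.
  by rewrite big_ord_recr.
rewrite (integral_past_present Xs_iid)//.
apply: (@le_trans _ _ (\int[Pr]_o ((S o ^+ 2)%:E + v%:E))%E).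
  apply: ge0_le_integral => //.
  - by move=> o _; exact: integral_ge0.
  - exact: measurable_on_past (measurable_fun_fubini_tonelli_F _ mh h0).
  - exact: emeasurable_funD.
  - by move=> o _; exact: (integral_sqr_shift_le (S o) mY iY EY VY).
rewrite ge0_integralD//; last by move=> o _; rewrite lee_fin sqr_ge0.
rewrite integral_cst//= probability_setT mule1 -natr1 mulrDl mul1r EFinD.
by rewrite leeD2r.
Qed.

End iid_recursions.

(** * Finite mixtures approximate means *)

Section greedy_average.
Context {R : realType} d1 d2 (Omega : measurableType d1) (M : measurableType d2).
Variables (Pr : probability Omega R) (nu : probability M R).

(** Otherwise J would be at least c + 1 almost everywhere, against its mean. This margin is the 1 in
    C^2 + 1 in [greedy_average]. *)
Lemma below_mean_gt0 (J : M -> \bar R) (c : R) : measurable_fun setT J ->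
  (forall t, 0 <= J t)%E -> (\int[nu]_t J t <= c%:E)%E ->
  (0 < nu [set t | (J t < (c + 1)%:E)%E])%E.
Proof.
move=> mJ J0 Jc; set D := [set t | _].
have mD : measurable D.
  by rewrite -[D]setTI; exact: emeasurable_fun_infty_o.
have c0 : 0 <= c by rewrite -lee_fin (le_trans _ Jc)// integral_ge0.
rewrite lt0e measure_ge0 andbT; apply/eqP => D0.
have D1 : (nu (~` D) = 1)%E by rewrite probability_setC// D0 sube0.
suff : (((c + 1)%:E) <= c%:E)%E by rewrite lee_fin; lra.
apply: le_trans Jc.
apply: (@le_trans _ _ (\int[nu]_(t in ~` D) J t)%E); last first.
  by apply: ge0_subset_integral => //; exact: measurableC.
rewrite -[leLHS]mule1 -D1 -integral_cst//; last exact: measurableC.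
apply: ge0_le_integral => //.
- exact: measurableC.
- by move=> t _; rewrite lee_fin addr_ge0.
- exact: measurable_funTS.
- by move=> t /= /negP; rewrite -leNgt.
Qed.

Variables (H : Omega * M -> R) (C : R) (A : set M).
Hypothesis mH : measurable_fun setT H.
Hypothesis H0C : forall z, 0 <= H z <= C.
Hypothesis hA : forall D, measurable D -> (0 < nu D)%E -> exists2 t, D t & A t.

Let mH1 w : measurable_fun setT (fun t => H (w, t)).
Proof. exact: (measurableT_comp mH (pair1_measurable w)). Qed.

Let mH2 t : measurable_fun setT (fun w => H (w, t)).
Proof. exact: (measurableT_comp mH (pair2_measurable t)). Qed.

Let iH w : nu.-integrable setT (fun t => (H (w, t))%:E).
Proof.
apply: (@le_integrable _ _ _ _ _ measurableT _ (EFin \o cst C)).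
- exact/measurable_EFinP.
- move=> t _ /=; case/andP: (H0C (w, t)) => h0 hC.
  by rewrite lee_fin !ger0_norm// (le_trans h0).
- exact: finite_measure_integrable_cst.
Qed.

Definition mean (w : Omega) : R := \int[nu]_t H (w, t).

Lemma EFin_mean w : ((mean w)%:E = \int[nu]_t (H (w, t))%:E)%E.
Proof. by rewrite /mean /Rintegral fineK//; exact: integrable_fin_num. Qed.

Lemma mean_bound w : 0 <= mean w <= C.
Proof.
rewrite -!lee_fin EFin_mean; apply/andP; split.
  by apply: integral_ge0 => t _; rewrite lee_fin; case/andP: (H0C (w, t)).
apply: (@le_trans _ _ (\int[nu]_t (C%:E))%E); last first.
  by rewrite integral_cst//= probability_setT mule1.
apply: ge0_le_integral => //.
- by move=> t _; rewrite lee_fin; case/andP: (H0C (w, t)).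
- exact/measurable_EFinP.
- by move=> t _; rewrite lee_fin; case/andP: (H0C (w, t)).
Qed.

Lemma measurable_mean : measurable_fun setT mean.
Proof.
apply/measurable_EFinP; rewrite (_ : _ \o _ = (fun w => \int[nu]_t (H (w, t))%:E)%E).
  apply: (measurable_fun_fubini_tonelli_F (fun z => (H z)%:E)).
    exact/measurable_EFinP.
  by move=> z; rewrite lee_fin; case/andP: (H0C z).
by apply/funext => w /=; rewrite EFin_mean.
Qed.

(* Maurey's argument: given points t_0, ..., t_(m-1), averaging over t makes the
   cross term vanish, so some admissible t adds at most C^2 + 1 to the squared
   L2 norm of the accumulated deviation. *)
Lemma greedy_average (m : nat) : exists2 t : nat -> M, forall j, A (t j) &
  (\int[Pr]_w ((\sum_(j < m) (H (w, t j) - mean w)) ^+ 2)%:E <=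
   (m%:R * (C ^+ 2 + 1))%:E)%E.
Proof.
elim: m => [|m [t At ih]].
  have [t _ At] : exists2 t, [set: M] t & A t by apply: hA; rewrite ?probability_setT.
  exists (fun=> t) => //.
  by under eq_integral do rewrite big_ord0 expr0n/=; rewrite integral0 mul0r.
pose s w := \sum_(j < m) (H (w, t j) - mean w).
have ms : measurable_fun setT s.
  by apply: measurable_sum => j; apply: measurable_funB => //; exact: measurable_mean.
pose F (z : Omega * M) := ((s z.1 + (H z - mean z.1)) ^+ 2)%:E.
have F0 z : (0 <= F z)%E by rewrite lee_fin sqr_ge0.
have mF : measurable_fun setT F.
  apply/measurable_EFinP; apply: measurable_funX; apply: measurable_funD.
    exact: (measurableT_comp ms measurable_fst).
  apply: measurable_funB => //.
  exact: (measurableT_comp measurable_mean measurable_fst).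
have inner w : (\int[nu]_t F (w, t) <= (s w ^+ 2)%:E + (C ^+ 2)%:E)%E.
  have mY : measurable_fun setT (fun t => H (w, t) - mean w).
    by apply: measurable_funB => //; exact: measurable_cst.
  apply: (integral_sqr_shift_le (s w) mY).
  - rewrite (_ : EFin \o _ = (fun t => (H (w, t))%:E - (mean w)%:E)%E)//.
    by apply: integrableB => //; exact: finite_measure_integrable_cst.
  - under eq_integral do rewrite EFinB.
    rewrite integralB//; last exact: finite_measure_integrable_cst.
    by rewrite -EFin_mean integral_cst//= probability_setT mule1 subee.
  - apply: (@le_trans _ _ (\int[nu]_t ((C ^+ 2)%:E))%E); last first.
      by rewrite integral_cst//= probability_setT mule1.
    apply: ge0_le_integral => //.
    + by move=> x _; rewrite lee_fin sqr_ge0.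
    + by apply/measurable_EFinP; exact: measurable_funX.
    + move=> x _; rewrite lee_fin -real_normK ?num_real// lerXn2r ?nnegrE//.
        by case/andP: (mean_bound w) => h0; exact: le_trans.
      rewrite ler_norml; have := mean_bound w; have := H0C (w, x).
      by move=> /andP[? ?] /andP[? ?]; lra.
have ms2 : measurable_fun setT (fun w => (s w ^+ 2)%:E).
  by apply/measurable_EFinP; exact: measurable_funX.
have JF : (\int[nu]_t \int[Pr]_w F (w, t) <= (m%:R * (C ^+ 2 + 1) + C ^+ 2)%:E)%E.
  rewrite -fubini_tonelli//.
  apply: (@le_trans _ _ (\int[Pr]_w ((s w ^+ 2)%:E + (C ^+ 2)%:E))%E).
    apply: ge0_le_integral => //.
    - by move=> w _; exact: integral_ge0.
    - exact: measurable_fun_fubini_tonelli_F.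
    - exact: emeasurable_funD.
  rewrite ge0_integralD//; last 2 first.
  - by move=> w _; rewrite lee_fin sqr_ge0.
  - by move=> w _; rewrite lee_fin sqr_ge0.
  by rewrite integral_cst//= probability_setT mule1 EFinD leeD2r.
have mJ : measurable_fun setT (fun t => \int[Pr]_w F (w, t))%E.
  exact: (measurable_fun_fubini_tonelli_G F).
have J0 t' : (0 <= \int[Pr]_w F (w, t'))%E by exact: integral_ge0.
(* Averaged over the new point, the cost grows by at most C^2; some admissible point stays less than
   1 above that bound. *)
have [|u /= Fu Au] := hA _ (below_mean_gt0 mJ J0 JF).
  by rewrite -[X in measurable X]setTI; exact: emeasurable_fun_infty_o.
exists (fun j => if (j < m)%N then t j else u); first by move=> j; case: ifP.
rewrite -natr1 mulrDl mul1r addrA; apply: le_trans (ltW Fu).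
rewrite le_eqVlt; apply/orP; left; apply/eqP; apply: eq_integral => w _.
rewrite /F/= big_ord_recr/= ltnn; congr ((_ + _) ^+ 2)%:E.
by apply: eq_bigr => j _; rewrite ltn_ord.
Qed.

End greedy_average.

(** * Mixtures of likelihoods over a piece of the cover *)

Section measurable_hull.
Context {R : realType} d (M : measurableType d) (Pi : probability M R).

(* The pieces of the cover are arbitrary convex sets, so their traces on the
   model need not be measurable. *)
Lemma measurable_hull (A : set M) : exists D, [/\ measurable D, A `<=` D &
  forall C, measurable C -> C `<=` D -> (0 < Pi C)%E -> exists2 t, C t & A t].
Proof.
pose S := [set r : R | exists D, [/\ measurable D, A `<=` D & r = fine (Pi D)]].
have hS : has_inf S.
  split; first by exists (fine (Pi setT)), setT.
  by exists 0 => _ [D [_ _ ->]]; rewrite fine_ge0.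
have /choice[D hD] (k : nat) : exists D, [/\ measurable D, A `<=` D &
    fine (Pi D) < inf S + k.+1%:R^-1].
  have k0 : 0 < k.+1%:R^-1 :> R by rewrite invr_gt0 ltr0n.
  by have [_ [D [mD AD ->]] lt] := inf_adherent k0 hS; exists D.
have mI : measurable (\bigcap_k D k).
  by apply: bigcapT_measurable => k; case: (hD k).
(* The intersection attains the infimum of the masses of measurable supersets of A, so a part of
   positive mass that misses A could be removed, a contradiction. *)
exists (\bigcap_k D k); split => //.
  by move=> x Ax k _; case: (hD k) => _ + _; apply.
move=> C mC CD C0; apply: contrapT => nCA.
have Cfin : Pi C \is a fin_num by rewrite fin_num_measure.
have : 0 < fine (Pi C) by rewrite fine_gt0// C0/= ltey_eq Cfin.
move=> /ltr_add_invr[k]; rewrite add0r; apply/negP; rewrite -leNgt.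
have [mDk ADk lt] := hD k.
have : inf S <= fine (Pi (D k `\` C)).
  apply: ge_inf; first by case: hS.
  exists (D k `\` C); split => //; first exact: measurableD.
  move=> x Ax; split; first exact: ADk.
  by move=> Cx; apply: nCA; exists x.
have CDk : C `<=` D k by move=> x /CD; apply.
have Dfin : Pi (D k) \is a fin_num by rewrite fin_num_measure.
have -> : fine (Pi (D k `\` C)) = fine (Pi (D k)) - fine (Pi C).
  rewrite measureD//; last by rewrite ltey_eq Dfin.
  by rewrite (setIidr CDk) fineB.
by rewrite lerBrDr => /le_lt_trans/(_ lt); rewrite ltrD2l => /ltW.
Qed.

End measurable_hull.

Section mixture_of_products.
Context {R : realType} dX (X : measurableType dX) dO (Omega : measurableType dO)
  dM (M : measurableType dM).
Variables (Pr : probability Omega R) (P0 : probability X R) (Pi : probability M R).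
Variable Xs : nat -> {mfun Omega >-> X}.
Hypothesis Xs_iid : iid Pr P0 Xs.
Variable g : M -> X -> R.
Hypothesis mg : measurable_fun setT (fun z : X * M => g z.2 z.1).
Hypothesis g0 : forall t x, 0 <= g t x.

Definition truncated_product (K : R) (n : nat) (z : Omega * M) : R :=
  \prod_(i < n) Num.min (g z.2 (Xs i z.1)) K.

Lemma measurable_likelihood (n : nat) :
  measurable_fun setT (fun z : Omega * M => \prod_(i < n) g z.2 (Xs i z.1)).
Proof.
apply: measurable_prod => i _.
apply: (measurableT_comp (f := fun z : X * M => g z.2 z.1) mg
  (g := fun z : Omega * M => (Xs i z.1, z.2))).
apply: measurable_fun_pair => //.
by apply: (measurableT_comp (f := Xs i)).
Qed.

Lemma measurable_truncated_product K n : measurable_fun setT (truncated_product K n).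
Proof.
apply: measurable_prod => i _; apply: measurable_minr => //.
apply: (measurableT_comp (f := fun z : X * M => g z.2 z.1) mg
  (g := fun z : Omega * M => (Xs i z.1, z.2))).
apply: measurable_fun_pair => //.
by apply: (measurableT_comp (f := Xs i)).
Qed.

Lemma truncated_product_bound K n z : 0 <= K ->
  0 <= truncated_product K n z <= K ^+ n.
Proof.
move=> K0; have h (i : 'I_n) : 0 <= Num.min (g z.2 (Xs i z.1)) K <= K.
  by rewrite le_min g0 K0/= ge_min lexx orbT.
apply/andP; split; first by apply: prodr_ge0 => i _; case/andP: (h i).
apply: le_trans (ler_prod _ (E2 := fun=> K) _) _; first by move=> i _; exact: h.
by rewrite prodr_const card_ord.
Qed.

Variables (A D : set M) (c : R).
Hypothesis mD : measurable D.
Hypothesis hull : forall C, measurable C -> C `<=` D -> (0 < Pi C)%E ->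
  exists2 t, C t & A t.
Hypothesis c0 : 0 <= c.
Hypothesis rate : forall K, 1 <= K -> exists2 a : R, 0 < a <= 1 &
  forall m (w : nat -> R) (t : nat -> M), (forall j, 0 <= w j) -> (forall j, A (t j)) ->
  (\int[P0]_x (((\sum_(j < m) w j * Num.min (g (t j) x) K) `^ a)%:E) <=
   (c * (\sum_(j < m) w j) `^ a)%:E)%E.

Let H K n (z : Omega * M) := \1_D z.2 * truncated_product K n z.

Let H_ge0 K n z : 0 <= K -> 0 <= H K n z.
Proof.
move=> K0; rewrite /H mulr_ge0// ?indicE ?ler0n//.
by case/andP: (truncated_product_bound n z K0).
Qed.

Let H_le K K' n z : 0 <= K -> K <= K' -> H K n z <= H K' n z.
Proof.
move=> K0 KK'; rewrite /H ler_wpM2l ?indicE ?ler0n//.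
apply: ler_prod => i _; rewrite le_min g0 K0/= le_min ge_min lexx/=.
by rewrite ge_min KK' orbT.
Qed.

Let mH K n : measurable_fun setT (H K n).
Proof.
apply: measurable_funM; last exact: measurable_truncated_product.
have mI : measurable_fun setT (\1_D : M -> R) by exact: measurable_indic.
exact: (measurableT_comp mI measurable_snd).
Qed.

Let H_bound K n z : 0 <= K -> 0 <= H K n z <= K ^+ n.
Proof.
move=> K0; rewrite H_ge0//=; have /andP[p0 pK] := truncated_product_bound n z K0.
rewrite /H indicE; case: (z.2 \in D); rewrite ?mul1r ?mul0r//.
by rewrite exprn_ge0.
Qed.

Let EFin_meanH K n w : 0 <= K ->
  ((mean Pi (H K n) w)%:E = \int[Pi]_t (H K n (w, t))%:E)%E.
Proof. by move=> K0; apply: (EFin_mean Pi (@mH K n) (C := K ^+ n)) => z; exact: H_bound. Qed.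

(** An average of m + 1 sampled products replaces the mean up to a mean square error of order 1 / m.
    Capped at 1, this average is below its a-th power, which [mixture_power_bound] controls. The
    factor [Num.max 1 d0^-1] dominates d0^(-a) for every a in (0, 1]. *)
Lemma truncated_mixture_bound (K d0 : R) n : 1 <= K -> 0 < d0 ->
  (\int[Pr]_w (Num.min 1 (mean Pi (H K n) w / d0))%:E <=
   (Num.max 1 d0^-1 * c ^+ n)%:E)%E.
Proof.
move=> K1 d0_gt0; have K0 : 0 <= K by exact: le_trans K1.
have B0 : 0 <= Num.max 1 d0^-1 * c ^+ n.
  by rewrite mulr_ge0 ?exprn_ge0// le_max ler01.
have H0K z : 0 <= H K n z <= K ^+ n by exact: H_bound.
have mmean := measurable_mean Pi (@mH K n) H0K.
have mmin : measurable_fun setT (fun w => (Num.min 1 (mean Pi (H K n) w / d0))%:E).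
  by apply/measurable_EFinP; apply: measurable_minr => //; exact: measurable_funM.
have mean0 w := proj1 (andP (mean_bound Pi (@mH K n) H0K w)).
have min0 w : (0 <= (Num.min 1 (mean Pi (H K n) w / d0))%:E)%E.
  by rewrite lee_fin le_min ler01/= divr_ge0// ltW.
(* If [A] is empty, [D] is null and the mean is 0; otherwise u is available as a placeholder. *)
have [[u Au]|nA] := pselect (exists t, A t); last first.
  have D0 : Pi D = 0%E.
    apply/eqP; rewrite eq_le measure_ge0 andbT leNgt; apply/negP => /(hull mD).
    by case=> // t _ At; apply: nA; exists t.
  have mean_eq0 w : mean Pi (H K n) w = 0.
    rewrite /mean /Rintegral (ge0_negligible_integral _ _ _ _ D0)//.
    - rewrite integral0_eq// => t [_ nDt].
      by rewrite /H indicE memNset// mul0r.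
    - by apply/measurable_EFinP; exact: (measurableT_comp (@mH K n) (pair1_measurable w)).
    - by move=> t _; rewrite lee_fin; case/andP: (H0K (w, t)).
  under eq_integral do rewrite mean_eq0 mul0r minEle ler10.
  by rewrite integral0 lee_fin.
have [a /andP[a_gt0 a_le1] hmix] := rate K1.
(* Sampling needs a set meeting every measurable set of positive mass. Points outside [D] may be
   added to [A] for that, since [H] vanishes there. *)
have hA C : measurable C -> (0 < Pi C)%E -> exists2 t, C t & (A `|` ~` D) t.
  move=> mC C0; have [[t [Ct nDt]]|nC] := pselect (exists t, C t /\ ~ D t).
    by exists t => //; right.
  have CD : C `<=` D by move=> t Ct; apply: contrapT => nDt; apply: nC; exists t.
  by have [t Ct At] := hull mC CD C0; exists t => //; left.
pose V := (K ^+ n) ^+ 2 + 1.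
have V0 : 0 < V by rewrite ltr_wpDl// sqr_ge0.
have approx (m : nat) (e : R) : 0 < e ->
  (\int[Pr]_w (Num.min 1 (mean Pi (H K n) w / d0))%:E <=
    (Num.max 1 d0^-1 * c ^+ n + (e / d0 + V / (e * d0 * m.+1%:R)))%:E)%E.
  move=> e0.
  have [t At L2] := greedy_average Pr (@mH K n) H0K hA m.+1.
  (* Samples outside [D] receive weight 0 and are replaced by u, so that [rate] applies with a point
     of [A] at every index. *)
  pose w j := if t j \in D then (m.+1%:R * d0)^-1 else 0.
  pose t' j := if t j \in D then t j else u.
  pose k j x := Num.min (g (t' j) x) K.
  pose S o := \sum_(j < m.+1) (H K n (o, t j) - mean Pi (H K n) o).
  pose Q o := \sum_(j < m.+1) w j * \prod_(i < n) k j (Xs i o).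
  have w0 j : 0 <= w j by rewrite /w; case: ifP => // _; rewrite invr_ge0 mulr_ge0// ltW.
  have At' j : A (t' j).
    rewrite /t'; case: ifPn => [|_//]; rewrite inE => Dt.
    by case: (At j) => // /(_ Dt).
  have QE o : Q o = (\sum_(j < m.+1) H K n (o, t j)) / (m.+1%:R * d0).
    rewrite /Q mulr_suml; apply: eq_bigr => j _; rewrite /w /k /t' /H indicE/=.
    by case: ifP => _; rewrite ?mul0r// mul1r mulrC.
  have mk j : measurable_fun setT (k j).
    apply: measurable_minr => //.
    exact: (measurableT_comp mg (pair2_measurable (t' j))).
  have k0 j x : 0 <= k j x by rewrite le_min g0.
  have mQ : measurable_fun setT Q.
    apply: measurable_sum => j; apply: measurable_funM => //.
    by apply: measurable_prod => i _; exact: measurableT_comp.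
  have Q0 o : 0 <= Q o by apply: sumr_ge0 => j _; rewrite mulr_ge0// prodr_ge0.
  have mS : measurable_fun setT S.
    apply: measurable_sum => j; apply: measurable_funB => //.
    exact: (measurableT_comp (@mH K n) (pair2_measurable (t j))).
  have mQa : measurable_fun setT (fun o => (Q o `^ a)%:E).
    by apply/measurable_EFinP; exact: (measurableT_comp (measurable_powR a)).
  have QB : (\int[Pr]_o (Q o `^ a)%:E <= (Num.max 1 d0^-1 * c ^+ n)%:E)%E.
    apply: (le_trans (mixture_power_bound Xs_iid a_gt0 c0 mk k0 _ n w0)).
      by move=> v v0; exact: hmix.
    rewrite lee_fin mulrC ler_wpM2r ?exprn_ge0//.
    have sw : 0 <= \sum_(j < m.+1) w j <= d0^-1.
      rewrite sumr_ge0//=; apply: (@le_trans _ _ (\sum_(j < m.+1) (m.+1%:R * d0)^-1)).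
        apply: ler_sum => j _; rewrite /w; case: ifP => // _.
        by rewrite invr_ge0 mulr_ge0// ltW.
      by rewrite sumr_const card_ord -[leLHS]mulr_natr invfM mulrAC mulVf ?mul1r// pnatr_eq0.
    case/andP: sw => sw0 sw1.
    apply: (@le_trans _ _ (d0^-1 `^ a)).
      by apply: ge0_ler_powR => //; rewrite ?nnegrE ?invr_ge0 ltW.
    have [d1|d1] := leP 1 d0^-1.
      by rewrite -[leRHS]powRr1 ?invr_ge0 ?(ltW d0_gt0)// ler_powR.
    have <- : 1 `^ a = 1 :> R by rewrite powR1.
    by apply: ge0_ler_powR; rewrite ?nnegrE ?invr_ge0// ltW.
  have pointwise o : ((Num.min 1 (mean Pi (H K n) o / d0))%:E <=
      (Q o `^ a)%:E + ((e / d0)%:E + ((e * d0 * m.+1%:R ^+ 2)^-1)%:E * (S o ^+ 2)%:E))%E.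
    rewrite -EFinM -!EFinD lee_fin.
    have m0 : (m.+1%:R : R) != 0 by rewrite pnatr_eq0.
    pose s := S o / m.+1%:R.
    have QS : Q o = mean Pi (H K n) o / d0 + s / d0.
      rewrite QE /s /S sumrB sumr_const card_ord -mulr_natr; field.
      by rewrite nat1r m0 gt_eqF.
    (* This trades the absolute error for the second moment bounded by [L2], at the price of e. *)
    have s_le : `|s| <= e + s ^+ 2 / e.
      rewrite -(real_normK (num_real s)) -(ler_pM2r e0) mulrDl -mulrA mulVf ?gt_eqF// mulr1.
      by have := sqr_ge0 (`|s| - e); have := mulr_ge0 (normr_ge0 s) (ltW e0); lra.
    have -> : e / d0 + (e * d0 * m.+1%:R ^+ 2)^-1 * S o ^+ 2 = (e + s ^+ 2 / e) / d0.
      by rewrite /s; field; rewrite nat1r !gt_eqF// ltr0n.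
    apply: (@le_trans _ _ (Num.min 1 (Q o) + `|s| / d0)); last first.
      by apply: lerD; [apply: min1_le_powR; rewrite ?Q0 ?a_gt0|
        rewrite ler_pM2r ?invr_gt0].
    have sd : - (`|s| / d0) <= s / d0.
      by rewrite -mulNr ler_pM2r ?invr_gt0// lerNl -normrN ler_norm.
    have sd0 : 0 <= `|s| / d0 by rewrite divr_ge0// ltW.
    have [Q1|Q1] := leP 1 (Q o).
      by rewrite (@le_trans _ _ 1)// ?ge_min ?lexx// lerDl.
    rewrite ge_min; apply/orP; right; rewrite QS -addrA lerDl -lerBlDr sub0r.
    by rewrite lerNl -mulNr ler_pM2r ?invr_gt0// -normrN ler_norm.
  have mS2 : measurable_fun setT (fun o => (S o ^+ 2)%:E).
    by apply/measurable_EFinP; exact: measurable_funX.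
  have ed0 : 0 <= e / d0 by rewrite divr_ge0// ltW.
  have coef0 : 0 <= (e * d0 * m.+1%:R ^+ 2)^-1.
    by rewrite invr_ge0 !mulr_ge0 ?sqr_ge0// ltW.
  have mZ : measurable_fun setT
      (fun o => ((e * d0 * m.+1%:R ^+ 2)^-1)%:E * (S o ^+ 2)%:E)%E.
    exact: emeasurable_funM.
  have Z0 o : (0 <= ((e * d0 * m.+1%:R ^+ 2)^-1)%:E * (S o ^+ 2)%:E)%E.
    by rewrite mule_ge0// lee_fin// sqr_ge0.
  apply: (le_trans (ge0_le_integral Pr measurableT _ _ _ (fun o _ => pointwise o))) => //.
    by apply: emeasurable_funD => //; exact: emeasurable_funD.
  rewrite ge0_integralD//; last 3 first.
  - by move=> o _; rewrite lee_fin powR_ge0.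
  - by move=> o _; rewrite adde_ge0.
  - exact: emeasurable_funD.
  rewrite ge0_integralD//.
  rewrite integral_cst//= probability_setT mule1 ge0_integralZl_EFin//; last first.
    by move=> o _; rewrite lee_fin sqr_ge0.
  rewrite [leRHS]EFinD; apply: leeD => //.
  rewrite EFinD leeD2l//; apply: le_trans (lee_wpmul2l _ L2) _; first by rewrite lee_fin.
  rewrite -EFinM lee_fin -/V le_eqVlt; apply/orP; left; apply/eqP; field.
  by rewrite nat1r !gt_eqF// ltr0n.
apply/lee_addgt0Pr => e e0.
have e1 : 0 < d0 * e / 2 by rewrite divr_gt0// mulr_gt0.
have : 0 < e / 2 * (d0 * e / 2 * d0 / V) by rewrite !mulr_gt0 ?invr_gt0.
move=> /ltr_add_invr[m]; rewrite add0r => hm.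
apply: (le_trans (approx m _ e1)).
rewrite -EFinD lee_fin lerD2l.
have -> : d0 * e / 2 / d0 = e / 2 by field; rewrite gt_eqF.
rewrite [leRHS](splitr e) lerD2l.
rewrite invfM mulrA ler_pdivrMr ?ltr0n//.
rewrite ler_pdivrMr; last by rewrite mulr_gt0.
move: hm; rewrite -(ltr_pM2r V0) mulrA mulfVK ?gt_eqF//.
rewrite -(ltr_pM2l (_ : 0 < m.+1%:R)) ?ltr0n// mulrA mulfV ?mul1r ?pnatr_eq0//.
by rewrite [X in _ < X]mulrCA mulrA => /ltW.
Qed.

(** At each point only finitely many factors occur, so truncation is eventually inactive; monotone
    convergence gives the rest. *)
Lemma mixture_likelihood_truncated n w :
  (\int[Pi]_(t in D) (\prod_(i < n) g t (Xs i w))%:E =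
   limn (fun k => (mean Pi (H k.+1%:R n) w)%:E))%E.
Proof.
rewrite integral_mkcond.
transitivity (\int[Pi]_t (limn (fun k => (H k.+1%:R n (w, t))%:E)))%E.
  apply: eq_integral => t _; apply/esym; apply: lim_near_cst => //.
  have : \forall k \near \oo, forall i : 'I_n, g t (Xs i w) <= k.+1%:R.
    apply: filter_forall => i; near=> k.
    rewrite (@le_trans _ _ k%:R) ?ler_nat//.
    by near: k; exact: nbhs_infty_ger.
  apply: filterS => k hk; rewrite /H /truncated_product patchE indicE/=.
  case: ifP => tD; last by rewrite mul0r.
  by rewrite mul1r; congr (_%:E); apply: eq_bigr => i _; exact/min_idPl.
rewrite monotone_convergence//.
- apply: congr_lim; apply/funext => k; rewrite EFin_meanH//.
- move=> k; apply/measurable_EFinP.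
  exact: (measurableT_comp (@mH _ n) (pair1_measurable w)).
- by move=> k t _; rewrite lee_fin H_ge0.
- by move=> t _ k l kl; rewrite lee_fin H_le// ler_nat.
Unshelve. all: by end_near. Qed.

(** The bound of [truncated_mixture_bound] involves neither K nor the exponent chosen for K, so K
    may tend to infinity. *)
Lemma mixture_bound (d0 : R) n : 0 < d0 ->
  (\int[Pr]_w (mine 1 ((\int[Pi]_(t in D) (\prod_(i < n) g t (Xs i w))%:E) *
    (d0^-1)%:E)) <= (Num.max 1 d0^-1 * c ^+ n)%:E)%E.
Proof.
move=> d0_gt0.
pose f w := (\int[Pi]_(t in D) (\prod_(i < n) g t (Xs i w))%:E)%E.
pose phi k w := (Num.min 1 (mean Pi (H k.+1%:R n) w / d0))%:E.
have K0 k : 0 <= k.+1%:R :> R by [].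
have mmean k : measurable_fun setT (mean Pi (H k.+1%:R n)).
  by apply: (measurable_mean Pi (@mH k.+1%:R n) (C := k.+1%:R ^+ n)) => z; exact: H_bound.
have mphi k : measurable_fun setT (phi k).
  by apply/measurable_EFinP; apply: measurable_minr => //; exact: measurable_funM.
have le_mean k l w : (k <= l)%N -> mean Pi (H k.+1%:R n) w <= mean Pi (H l.+1%:R n) w.
  move=> kl; rewrite -lee_fin !EFin_meanH//.
  apply: ge0_le_integral => //.
  - by move=> t _; rewrite lee_fin H_ge0.
  - by apply/measurable_EFinP; exact: (measurableT_comp (@mH _ n) (pair1_measurable w)).
  - by apply/measurable_EFinP; exact: (measurableT_comp (@mH _ n) (pair1_measurable w)).
  - by move=> t _; rewrite lee_fin H_le// ler_nat.
have mean0 k w : 0 <= mean Pi (H k.+1%:R n) w.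
  by have /andP[] := mean_bound Pi (@mH k.+1%:R n) (fun z => H_bound n z (K0 k)) w.
have phi0 k w : (0 <= phi k w)%E.
  by rewrite lee_fin le_min ler01/= divr_ge0// ltW.
have ndphi w : {homo phi^~ w : k l / (k <= l)%N >-> (k <= l)%E}.
  move=> k l kl; rewrite lee_fin le_min ge_min lexx/=.
  by rewrite ge_min ler_pM2r ?invr_gt0// le_mean// orbT.
have mf : measurable_fun setT f.
  rewrite (_ : f = (fun w => limn (fun k => (mean Pi (H k.+1%:R n) w)%:E))); last first.
    by apply/funext => w; exact: mixture_likelihood_truncated.
  apply: (emeasurable_fun_cvg (fun k w => (mean Pi (H k.+1%:R n) w)%:E)).
    by move=> k; exact/measurable_EFinP.
  move=> w _; apply: ereal_nondecreasing_is_cvgn => k l kl.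
  by rewrite lee_fin le_mean.
have lim_ge k w : (phi k w <= limn (phi^~ w))%E.
  rewrite (cvg_lim _ (ereal_nondecreasing_cvgn (ndphi w)))//.
  by apply: ereal_sup_ubound; exists k.
have pointwise w : (mine 1 (f w * (d0^-1)%:E) <= limn (phi^~ w))%E.
  have [L1|L1] := leP 1%E (limn (phi^~ w)); first by rewrite ge_min L1.
  rewrite ge_min; apply/orP; right.
  have L0 : (0 <= limn (phi^~ w))%E by exact: le_trans (phi0 0%N w) (lim_ge 0%N w).
  have Lfin : limn (phi^~ w) \is a fin_num.
    by rewrite ge0_fin_numE// (lt_trans L1)// ltry.
  rewrite -(fineK Lfin); set l := fine _.
  (* A limit below 1 means that the cap is inactive at every k, so all truncated means are at most l
     * d0. *)
  have fl : (f w <= (l * d0)%:E)%E.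
    rewrite /f mixture_likelihood_truncated; apply: lime_le.
      by apply: ereal_nondecreasing_is_cvgn => i j ij; rewrite lee_fin le_mean.
    apply: nearW => k; rewrite lee_fin -ler_pdivrMr//.
    have := lim_ge k w; rewrite -(fineK Lfin) lee_fin -/l ge_min => /orP[l1|//].
    by move: L1; rewrite -(fineK Lfin) lte_fin -/l ltNge l1.
  apply: le_trans (lee_wpmul2r _ fl) _; first by rewrite lee_fin invr_ge0 ltW.
  by rewrite -EFinM mulfK ?gt_eqF.
apply: (@le_trans _ _ (\int[Pr]_w limn (phi^~ w))%E).
  apply: ge0_le_integral => //.
  - move=> w _; rewrite le_min lee01/= mule_ge0//.
      by apply: integral_ge0 => t _; rewrite lee_fin prodr_ge0.
    by rewrite lee_fin invr_ge0 ltW.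
  - by apply: measurable_mine => //; exact: emeasurable_funM.
  - apply: (emeasurable_fun_cvg phi) => // w _.
    exact: ereal_nondecreasing_is_cvgn.
- by move=> w _; exact: pointwise.
rewrite monotone_convergence//.
apply: lime_le.
  apply: ereal_nondecreasing_is_cvgn => k l kl.
  by apply: ge0_le_integral => // w _; exact: ndphi.
by apply: nearW => k; apply: truncated_mixture_bound => //; rewrite ler1n.
Qed.

End mixture_of_products.

(** * Lower bound on the evidence *)

Lemma measurable_set_lt {R : realType} d (T : measurableType d) (f g : T -> R) :
  measurable_fun setT f -> measurable_fun setT g -> measurable [set x | f x < g x].
Proof.
move=> mf mg; rewrite (_ : [set x | _] = ~` [set x | g x <= f x]); last first.
  by apply/seteqP; split=> x /=; [move=> fg; rewrite leNgt fg|move=> /negP; rewrite -ltNge].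
by apply: measurableC; rewrite -[X in measurable X]setTI; exact: measurable_fun_le.
Qed.

Section evidence.
Context {R : realType} dX (X : measurableType dX) dO (Omega : measurableType dO)
  dM (M : measurableType dM).
Variables (Pr : probability Omega R) (P0 : probability X R) (Pi : probability M R).
Variable Xs : nat -> {mfun Omega >-> X}.
Hypothesis Xs_iid : iid Pr P0 Xs.

Lemma iid_null_events (N : set X) : measurable N -> P0 N = 0%E ->
  measurable (\bigcup_i (Xs i @^-1` N)) /\ Pr (\bigcup_i (Xs i @^-1` N)) = 0%E.
Proof.
move=> mN N0.
have mNi i : measurable (Xs i @^-1` N).
  by rewrite -[X in measurable X]setTI; exact: measurable_funP.
have mU : measurable (\bigcup_i (Xs i @^-1` N)) by exact: bigcupT_measurable.
split=> //; apply/eqP; rewrite eq_le measure_ge0 andbT.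
apply: le_trans (measure_sigma_subadditive _ mNi mU _) _ => //.
by rewrite eseries0// => i _ _; case: Xs_iid => /(_ i N mN) + _; rewrite N0.
Qed.

(** One n * e2 in the exponent pays for the mean of the log-likelihood ratio, the other for a
    deviation, whose probability is at most n * e2 / (n * e2)^2. *)
Lemma chebyshev_likelihood (f : X -> R) (e2 : R) n :
  measurable_fun setT f -> (forall x, 0 <= f x) -> P0 [set x | f x = 0] = 0%E ->
  P0.-integrable setT (fun x => (ln (f x))%:E) ->
  ((- e2)%:E <= \int[P0]_x (ln (f x))%:E)%E ->
  (\int[P0]_x (ln (f x) ^+ 2)%:E <= e2%:E)%E ->
  0 < e2 -> (0 < n)%N ->
  (Pr [set w | (\prod_(i < n) f (Xs i w) < expR (- (2 * n%:R * e2)))%R] <=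
   ((n%:R * e2)^-1)%:E)%E.
Proof.
move=> mf f0 Pf0 iln Eln Vln e20 n0.
have n0R : 0 < n%:R :> R by rewrite ltr0n.
have ne0 : 0 < n%:R * e2 by rewrite mulr_gt0.
pose m := \int[P0]_x ln (f x).
have mE : (m%:E = \int[P0]_x (ln (f x))%:E)%E.
  by rewrite /m /Rintegral fineK//; exact: integrable_fin_num.
have m_ge : - e2 <= m by rewrite -lee_fin mE.
have mln : measurable_fun setT (fun x => ln (f x)).
  exact: (measurableT_comp (@measurable_ln R) mf).
pose Y x := ln (f x) - m.
have mY : measurable_fun setT Y by exact: measurable_funB.
have iY : P0.-integrable setT (EFin \o Y).
  rewrite (_ : EFin \o _ = (fun x => (ln (f x))%:E - m%:E)%E)//.
  by apply: integrableB => //; exact: finite_measure_integrable_cst.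
have EY : (\int[P0]_x (Y x)%:E = 0)%E.
  under eq_integral do rewrite EFinB.
  rewrite integralB//; last exact: finite_measure_integrable_cst.
  by rewrite -mE integral_cst//= probability_setT mule1 subee.
have iln2 : P0.-integrable setT (fun x => (ln (f x) ^+ 2)%:E).
  apply/integrableP; split; first by apply/measurable_EFinP; exact: measurable_funX.
  under eq_integral do rewrite gee0_abs ?lee_fin ?sqr_ge0//.
  by rewrite (le_lt_trans Vln)// ltry.
have VY : (\int[P0]_x (Y x ^+ 2)%:E <= e2%:E)%E.
  have E x : ((Y x ^+ 2)%:E =
      (ln (f x) ^+ 2)%:E + ((- (2 * m))%:E * (ln (f x))%:E + (m ^+ 2)%:E))%E.
    by rewrite -EFinM -!EFinD /Y; congr (_%:E); ring.
  under eq_integral do rewrite E.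
  have iZ : P0.-integrable setT (fun x => ((- (2 * m))%:E * (ln (f x))%:E)%E).
    exact: integrableZl.
  rewrite integralD//; last first.
    by apply: integrableD => //; exact: finite_measure_integrable_cst.
  rewrite integralD//; last exact: finite_measure_integrable_cst.
  rewrite integralZl// -mE integral_cst//= probability_setT mule1.
  rewrite (_ : (_ + (m ^+ 2)%:E)%E = (- m ^+ 2)%:E); last first.
    by rewrite -EFinM -EFinD; congr (_%:E); ring.
  by apply: le_trans Vln; rewrite geeDl// lee_fin oppr_le0 sqr_ge0.
pose S w := \sum_(i < n) Y (Xs i w).
have mS : measurable_fun setT S by apply: measurable_sum => i; exact: measurableT_comp.
have mf0 : measurable [set x | f x = 0].
  rewrite -[X in measurable X]setTI; apply: (mf measurableT [set 0]).
  exact: measurable_set1.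
have [mZ Z0] := iid_null_events mf0 Pf0.
pose T := [set w | ((n%:R * e2) ^+ 2 <= S w ^+ 2)%R].
have mS2 : measurable_fun setT (fun w => S w ^+ 2) by exact: measurable_funX.
have mT : measurable T.
  by rewrite -[T]setTI; apply: measurable_fun_le => //; exact: measurable_cst.
have PT : (Pr T <= ((n%:R * e2)^-1)%:E)%E.
  have a0 : 0 < (n%:R * e2) ^+ 2 by rewrite exprn_gt0.
  have mS2E : measurable_fun setT (fun w => (S w ^+ 2)%:E) by exact/measurable_EFinP.
  have := le_integral_abse Pr measurableT mS2E a0.
  rewrite setTI (_ : [set x | _] = T); last first.
    by apply/seteqP; split=> w /=; rewrite lee_fin ger0_norm ?sqr_ge0.
  under eq_integral do rewrite gee0_abs ?lee_fin ?sqr_ge0//.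
  move=> /le_trans/(_ (second_moment_iid_sum Xs_iid mY iY EY VY n)).
  rewrite muleC -lee_pdivlMr// => /le_trans; apply.
  rewrite -EFinM lee_fin le_eqVlt; apply/orP; left; apply/eqP; field.
  by rewrite !gt_eqF.
apply: le_trans PT; rewrite -[leRHS]add0e -Z0.
have mL : measurable [set w | (\prod_(i < n) f (Xs i w) < expR (- (2 * n%:R * e2)))%R].
  apply: measurable_set_lt => //.
  by apply: measurable_prod => i _; exact: measurableT_comp.
apply: le_trans (measureU2 _ _ _) => //.
apply: le_measure; rewrite ?inE//; first exact: measurableU.
move=> w /= Lw; have [Zw|nZw] := pselect ((\bigcup_i (Xs i @^-1` [set x | f x = 0])) w).
  by left.
right; rewrite /T/=.
have f_gt0 i : 0 < f (Xs i w).
  by rewrite lt_def f0 andbT; apply/eqP => fi0; apply: nZw; exists i.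
(* The real [ln] has a finite default value at 0, so this identity is used only off the null event
   where some factor vanishes. *)
move: Lw; have -> : \prod_(i < n) f (Xs i w) = expR (\sum_(i < n) ln (f (Xs i w))).
  by rewrite expR_sum; apply: eq_bigr => i _; rewrite lnK// posrE.
rewrite ltr_expR => Lw.
have Sw : S w <= - (n%:R * e2).
  rewrite /S sumrB sumr_const card_ord -[X in _ - X]mulr_natl.
  have : n%:R * - e2 <= n%:R * m by rewrite ler_wpM2l.
  by move: Lw; set s := \sum_(i < n) _; lra.
have -> : S w ^+ 2 = (- S w) ^+ 2 by rewrite sqrrN.
have Sw' : n%:R * e2 <= - S w by rewrite lerNr.
by rewrite lerXn2r// nnegrE ?(ltW ne0)//; exact: le_trans (ltW ne0) Sw'.
Qed.

Variable g : M -> X -> R.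
Hypothesis mg : measurable_fun setT (fun z : X * M => g z.2 z.1).
Hypothesis g0 : forall t x, 0 <= g t x.

(** Let b(w) be the prior mass of the points of B whose likelihood ratio is below the threshold E.
    Its expectation is at most Pi B / (n * e2), and the evidence is at least E (Pi B - b(w));
    Markov's inequality at level Pi B / 2 yields the factor 2. *)
Lemma evidence_lower_bound (B : set M) (e2 : R) n : measurable B -> (0 < Pi B)%E ->
  0 < e2 -> (0 < n)%N ->
  (forall t, B t ->
    (Pr [set w | (\prod_(i < n) g t (Xs i w) < expR (- (2 * n%:R * e2)))%R] <=
     ((n%:R * e2)^-1)%:E)%E) ->
  (Pr [set w | \int[Pi]_t (\prod_(i < n) g t (Xs i w))%:E <
      (expR (- (2 * n%:R * e2)) * fine (Pi B) / 2)%:E] <= (2 / (n%:R * e2))%:E)%E.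
Proof.
move=> mB B0 e20 n0 hB.
have n0R : 0 < n%:R :> R by rewrite ltr0n.
have ne0 : 0 < n%:R * e2 by rewrite mulr_gt0.
set E := expR _ in hB *.
have E0 : 0 < E by exact: expR_gt0.
have Bfin : Pi B \is a fin_num by rewrite fin_num_measure.
pose p := fine (Pi B).
have pE : Pi B = p%:E by rewrite fineK.
have p0 : 0 < p by rewrite -lte_fin -pE.
have IB : (\int[Pi]_t (\1_B t)%:E = p%:E)%E by rewrite integral_indic// setIT.
pose lik (z : Omega * M) := \prod_(i < n) g z.2 (Xs i z.1).
have mlik : measurable_fun setT lik by exact: (measurable_likelihood Xs mg n).
pose N := [set z : Omega * M | (lik z < E)%R /\ B z.2].
have mN : measurable N.
  apply: (@measurableI _ _ [set z | lik z < E] [set z : Omega * M | B z.2]).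
    exact: measurable_set_lt.
  by rewrite -[X in measurable X]setTI; exact: (measurable_snd measurableT _ mB).
have mIN : measurable_fun setT (fun z => (\1_N z : R)%:E).
  by apply/measurable_EFinP; exact: measurable_indic.
have IN0 z : (0 <= (\1_N z : R)%:E)%E by rewrite lee_fin indicE ler0n.
pose b w := (\int[Pi]_t (\1_N (w, t) : R)%:E)%E.
have mb : measurable_fun setT b by exact: (measurable_fun_fubini_tonelli_F _ mIN IN0).
have b0 w : (0 <= b w)%E by exact: integral_ge0.
have b_small : (\int[Pr]_w b w <= (p / (n%:R * e2))%:E)%E.
  rewrite /b (fubini_tonelli _ mIN IN0).
  apply: (@le_trans _ _ (\int[Pi]_t (((n%:R * e2)^-1)%:E * (\1_B t)%:E))%E).
    apply: ge0_le_integral => //.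
    - by move=> t _; exact: integral_ge0.
    - exact: (measurable_fun_fubini_tonelli_G _ mIN IN0).
    - apply: emeasurable_funM => //; apply/measurable_EFinP; exact: measurable_indic.
    - move=> t _; have [Bt|nBt] := pselect (B t); last first.
        rewrite integral0_eq ?mule_ge0 ?lee_fin ?invr_ge0 ?(ltW ne0) ?indicE ?ler0n//.
        by move=> w _; rewrite indicE memNset//= => -[].
      rewrite [in leRHS]indicE mem_set// mule1.
      have mL : measurable [set w | lik (w, t) < E].
        apply: measurable_set_lt => //.
        exact: (measurableT_comp mlik (pair2_measurable t)).
      apply: le_trans (hB t Bt).
      rewrite -[leRHS](_ : \int[Pr]_w (\1_[set w | lik (w, t) < E] w)%:E = _)%E; last first.
        by rewrite integral_indic// setIT.
      rewrite le_eqVlt; apply/orP; left; apply/eqP; apply: eq_integral => w _.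
      rewrite !indicE; congr ((nat_of_bool _)%:R%:E).
      by apply/idP/idP; rewrite !inE => // -[].
  rewrite ge0_integralZl_EFin ?invr_ge0 ?(ltW ne0)//; last first.
    by apply/measurable_EFinP; exact: measurable_indic.
  by rewrite IB -EFinM mulrC.
pose D w := (\int[Pi]_t (lik (w, t))%:E)%E.
have mlikE : measurable_fun setT (fun z => (lik z)%:E) by exact/measurable_EFinP.
have lik0 z : (0 <= (lik z)%:E)%E by rewrite lee_fin prodr_ge0.
have mD : measurable_fun setT D by exact: (measurable_fun_fubini_tonelli_F _ mlikE lik0).
have D_ge w : ((E * p)%:E <= D w + E%:E * b w)%E.
  have mw : measurable_fun setT (fun t => (lik (w, t))%:E).
    exact: (measurableT_comp mlikE (pair1_measurable w)).
  have mNw : measurable_fun setT (fun t => (\1_N (w, t) : R)%:E).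
    exact: (measurableT_comp mIN (pair1_measurable w)).
  rewrite /D /b -ge0_integralZl_EFin// ?(ltW E0)//.
  have EN0 t : (0 <= E%:E * (\1_N (w, t) : R)%:E)%E by rewrite mule_ge0// lee_fin ltW.
  have mEN : measurable_fun setT (fun t => E%:E * (\1_N (w, t) : R)%:E)%E.
    exact: emeasurable_funM.
  rewrite -ge0_integralD//.
  have -> : ((E * p)%:E = \int[Pi]_t (E%:E * (\1_B t)%:E))%E.
    rewrite ge0_integralZl_EFin ?(ltW E0)//.
    - by rewrite IB.
    - by apply/measurable_EFinP; exact: measurable_indic.
  apply: ge0_le_integral => //.
  - by move=> t _; rewrite mule_ge0// lee_fin ltW.
  - by apply: emeasurable_funM => //; apply/measurable_EFinP; exact: measurable_indic.
  - exact: emeasurable_funD.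
  - move=> t _; rewrite -!EFinM -EFinD lee_fin.
    have l0 : 0 <= lik (w, t) by rewrite -lee_fin.
    have [Bt|nBt] := pselect (B t); last first.
      by rewrite [leLHS]mulrC indicE memNset// mul0r addr_ge0// mulr_ge0 ?indicE ?ler0n// ltW.
    have [lE|lE] := ltP (lik (w, t)) E.
      by rewrite !indicE !mem_set// mulr1 lerDr.
    by rewrite [X in X <= _]mulrC indicE mem_set// mul1r ler_wpDr// mulr_ge0 ?indicE ?ler0n// ltW.
have pn0 : 0 < p / 2 by rewrite divr_gt0.
have := le_integral_abse Pr measurableT mb pn0; rewrite setTI.
under eq_integral do rewrite gee0_abs//.
move=> /le_trans/(_ b_small); rewrite muleC -lee_pdivlMr// => h.
have -> : ((2 / (n%:R * e2))%:E = (p / (n%:R * e2))%:E * ((p / 2)^-1)%:E)%E.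
  rewrite -EFinM; congr (_%:E); field.
  by rewrite !gt_eqF.
apply: le_trans h; apply: le_measure; rewrite ?inE//.
- by rewrite -[X in measurable X]setTI; exact: emeasurable_fun_infty_o.
- rewrite -[X in measurable X]setTI; apply: emeasurable_fun_c_infty => //.
  exact: measurableT_comp.
- move=> w /= Dw; rewrite gee0_abs// leNgt; apply/negP => bw.
  have := D_ge w; rewrite leNgt => /negP; apply.
  have -> : ((E * p)%:E = (E * p / 2)%:E + E%:E * (p / 2)%:E)%E.
    by rewrite -EFinM -EFinD; congr (_%:E); field.
  by apply: lteD => //; rewrite lte_pmul2l.
Qed.

End evidence.

(** * Log-likelihood moments and testing sets *)

Section log_ratio.
Context {R : realType} d (T : measurableType d) (P0 : probability T R).

Lemma measurable_lne_comp dS (S : measurableType dS) (f : S -> R) :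
  measurable_fun setT f -> measurable_fun setT (fun x => lne (f x)%:E).
Proof.
move=> mf; rewrite (_ : (fun x => _) =
    (fun x => if (f x <= 0)%R then -oo%E else (ln (f x))%:E)) //.
apply: measurable_fun_ifT => //.
- by apply: measurable_fun_ler => //; exact: measurable_cst.
- by apply/measurable_EFinP; exact: (measurableT_comp (@measurable_ln R) mf).
Qed.

(** The square of [lne 0] is +oo, so a finite second moment makes the zero set of f null; [lne] and
    the real [ln] then agree almost everywhere. *)
Lemma log_ratio_moments (f : T -> R) (e2 : R) : measurable_fun setT f ->
  (forall x, 0 <= f x) ->
  (- (\int[P0]_x lne (f x)%:E) <= e2%:E)%E ->
  (\int[P0]_x (lne (f x)%:E) ^+ 2 <= e2%:E)%E ->
  [/\ P0 [set x | f x = 0] = 0%E,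
      P0.-integrable setT (fun x => (ln (f x))%:E),
      ((- e2)%:E <= \int[P0]_x (ln (f x))%:E)%E &
      (\int[P0]_x (ln (f x) ^+ 2)%:E <= e2%:E)%E].
Proof.
move=> mf f0 Elne Vlne.
have mN : measurable [set x | f x = 0].
  rewrite -[X in measurable X]setTI; apply: (mf measurableT [set 0]).
  exact: measurable_set1.
have mlne := measurable_lne_comp mf.
have sqr0 x : (0 <= (lne (f x)%:E) ^+ 2)%E by exact: sqre_ge0.
have msqr : measurable_fun setT (fun x => (lne (f x)%:E) ^+ 2)%E.
  by rewrite (_ : (fun x => _) = (fun x => lne (f x)%:E * lne (f x)%:E)%E)//; exact: emeasurable_funM.
have N0 : P0 [set x | f x = 0] = 0%E.
  apply/eqP/negPn/negP => N0.
  suff : (+oo <= e2%:E)%E by rewrite leye_eq.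
  apply: le_trans Vlne.
  apply: (@le_trans _ _ (\int[P0]_(x in [set x | f x = 0%R]) (lne (f x)%:E) ^+ 2)%E); last first.
    exact: ge0_subset_integral.
  rewrite (eq_integral (cst +oo%E)).
    by rewrite integral_cst// gt0_mulye// lt0e N0 measure_ge0.
  by move=> x; rewrite inE /= => ->; rewrite lexx.
have ae_lne : ae_eq P0 setT (fun x => lne (f x)%:E) (fun x => (ln (f x))%:E).
  exists [set x | f x = 0]; split => // x /= nx; apply: contrapT => fx0.
  by apply: nx => _; rewrite leNgt lt_def f0 andbT; move/eqP: fx0 => ->.
have mln : measurable_fun setT (fun x => ln (f x)).
  exact: (measurableT_comp (@measurable_ln R) mf).
have mlnE : measurable_fun setT (fun x => (ln (f x))%:E) by exact/measurable_EFinP.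
have Vln : (\int[P0]_x (ln (f x) ^+ 2)%:E <= e2%:E)%E.
  rewrite (ge0_ae_eq_integral (g := fun x => (lne (f x)%:E) ^+ 2)%E)//.
  - by apply/measurable_EFinP; exact: measurable_funX.
  - by move=> x _; rewrite lee_fin sqr_ge0.
  - case: ae_lne => A [mA A0 sub]; exists A; split => // x /= nx; apply: sub => /= h.
    by apply: nx => _; rewrite h.
have iln : P0.-integrable setT (fun x => (ln (f x))%:E).
  apply: (@le_integrable _ _ _ _ _ measurableT _ (fun x => (1 + ln (f x) ^+ 2)%:E)) => //.
    move=> x _; rewrite lee_fin [leRHS]ger0_norm ?addr_ge0 ?sqr_ge0//.
    rewrite -[X in _ <= 1 + X]real_normK ?num_real//.
    by have := sqr_ge0 (`|ln (f x)| - 1); have := normr_ge0 (ln (f x)); set y := `|_|; nra.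
  rewrite (_ : (fun x => _) = (fun x => 1%:E + (ln (f x) ^+ 2)%:E)%E)//.
  apply: integrableD => //; first exact: finite_measure_integrable_cst.
  apply/integrableP; split; first by apply/measurable_EFinP; exact: measurable_funX.
  under eq_integral do rewrite gee0_abs ?lee_fin ?sqr_ge0//.
  by rewrite (le_lt_trans Vln)// ltry.
split => //.
by rewrite EFinN leeNl -(ae_eq_integral _ _ measurableT mlne mlnE ae_lne).
Qed.

Lemma log_ratio_pos (f : T -> R) : measurable_fun setT f -> (forall x, 0 <= f x) ->
  (- (\int[P0]_x lne (f x)%:E) < +oo)%E -> P0 [set x | f x = 0] = 0%E.
Proof.
move=> mf f0 Elne.
have mN : measurable [set x | f x = 0].
  rewrite -[X in measurable X]setTI; apply: (mf measurableT [set 0]).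
  exact: measurable_set1.
have mlne := measurable_lne_comp mf.
apply/eqP/negPn/negP => N0.
(* Once the negative part integrates to +oo, the whole integral is -oo whatever the positive part
   is, which contradicts [Elne]. *)
suff neg : (\int[P0]_x (fun x => lne (f x)%:E)^\- x = +oo)%E.
  move: Elne; rewrite integralE neg.
  by case: (\int[P0]_x _)%E.
apply/eqP; rewrite -leye_eq.
apply: (@le_trans _ _ (\int[P0]_(x in [set x | f x = 0%R]) (fun x => lne (f x)%:E)^\- x)%E); last first.
  by apply: ge0_subset_integral => //; exact: measurable_funeneg.
rewrite (eq_integral (cst +oo%E)).
  by rewrite integral_cst// gt0_mulye// lt0e N0 measure_ge0.
by move=> x; rewrite inE /= funenegE => ->; rewrite lexx.
Qed.

End log_ratio.

(** * Power moments of likelihood ratios over a testing set *)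

Section testing_sets.
Context {R : realType} dX (X : measurableType dX).
Variables (mu : {measure set X -> \bar R}) (P0 : probability X R).

Lemma mixture_probability (P Q : probability X R) (t : R) : 0 <= t <= 1 ->
  exists S : probability X R, forall A, S A = (t%:E * P A + (1 - t)%:E * Q A)%E.
Proof.
move=> /andP[t0 t1]; have t1' : 0 <= 1 - t by rewrite subr_ge0.
pose m : {measure set X -> \bar R} := measure_add (mscale (NngNum t0) P) (mscale (NngNum t1') Q).
have mE A : m A = (t%:E * P A + (1 - t)%:E * Q A)%E by exact: measure_addE.
have m1 : m setT = 1%E.
  by rewrite mE !probability_setT !mule1 -EFinD addrC subrK.
(* The mixture already has mass 1; normalising only packages it as a [probability]. *)
exists (mnormalize m P) => A; rewrite -mE /= /mnormalize m1/=.
by rewrite onee_eq0/= invr1 mule1.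
Qed.

Lemma density_mixture (P Q S : probability X R) (p q : X -> R) (t : R) :
  0 <= t <= 1 -> (forall A, S A = (t%:E * P A + (1 - t)%:E * Q A)%E) ->
  is_density mu P p -> is_density mu Q q ->
  is_density mu S (fun x => t * p x + (1 - t) * q x).
Proof.
move=> /andP[t0 t1] SE [mp p0 pE] [mq q0 qE]; have t1' : 0 <= 1 - t by rewrite subr_ge0.
split.
- by apply: measurable_funD; exact: measurable_funM.
- by move=> x; rewrite addr_ge0// mulr_ge0.
- move=> A mA; rewrite SE pE// qE//.
  have mpE : measurable_fun A (fun x => (p x)%:E).
    by apply: measurable_funTS; exact/measurable_EFinP.
  have mqE : measurable_fun A (fun x => (q x)%:E).
    by apply: measurable_funTS; exact/measurable_EFinP.
  have p0E x : A x -> (0 <= (p x)%:E)%E by rewrite lee_fin.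
  have q0E x : A x -> (0 <= (q x)%:E)%E by rewrite lee_fin.
  rewrite -!ge0_integralZl_EFin// -ge0_integralD//.
  + by move=> x Ax; rewrite mule_ge0 ?p0E ?lee_fin.
  + exact: emeasurable_funM.
  + by move=> x Ax; rewrite mule_ge0 ?q0E ?lee_fin.
  + exact: emeasurable_funM.
Qed.

Variables (pstar : X -> R) (e : R) (B : set (probability X R)).
Hypothesis pstar0 : forall x, 0 <= pstar x.
Hypothesis e0 : 0 < e.
Hypothesis B_testing : testing_set mu P0 pstar e B.

(** A piece may contain distributions outside the model, whose ratio to [pstar] need not be
    P0-integrable. Those are dropped; the rest is still convex. *)
Definition integrable_ratios : set (X -> R) := [set h | exists P p,
  [/\ B P, is_density mu P p, h = (fun x => p x / pstar x) &
      P0.-integrable setT (EFin \o h)]].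

Let ratio_meas h : integrable_ratios h -> measurable_fun setT h.
Proof. by move=> [P [p [_ _ _ ih]]]; exact/measurable_EFinP/(measurable_int P0). Qed.

Let ratio_ge0 h x : integrable_ratios h -> 0 <= h x.
Proof. by move=> [P [p [_ [_ p0 _] -> _]]]; rewrite divr_ge0. Qed.

Let ratio_int h : integrable_ratios h -> P0.-integrable setT (EFin \o h).
Proof. by move=> [P [p []]]. Qed.

Let ratio_convex h k (t : R) : integrable_ratios h -> integrable_ratios k ->
  0 <= t <= 1 -> integrable_ratios (fun x => t * h x + (1 - t) * k x).
Proof.
move=> [P [p [BP dp -> ih]]] [Q [q [BQ dq -> ik]]] t01.
have [S SE] := mixture_probability P Q t01.
have [Bconvex _ _] := B_testing.
exists S, (fun x => t * p x + (1 - t) * q x); split.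
- by apply: (Bconvex P Q S t) => // A mA; exact: SE.
- exact: density_mixture SE dp dq.
- by apply/funext => x; rewrite [RHS]mulrDl !mulrA.
- rewrite (_ : EFin \o _ = (fun x => t%:E * (p x / pstar x)%:E +
    (1 - t)%:E * (q x / pstar x)%:E)%E)//.
  by apply: integrableD => //; exact: integrableZl.
Qed.

Let ratio_rate h : integrable_ratios h ->
  exists2 a : R, 0 < a < 1 & \int[P0]_x (h x `^ a) < expR (- (e ^+ 2 / 8)).
Proof.
move=> Gh; have [P [p [BP dp hE ih]]] := Gh.
have [_ _ Binf] := B_testing.
(* The supremum over exponents need not be attained; 1/8 in place of 1/4 gives a strict inequality,
   hence an actual exponent. *)
have : (((e ^+ 2 / 8)%:E) < testing_rate P0 pstar p)%E.
  apply: (@lt_le_trans _ _ (e ^+ 2 / 4)%:E).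
    by rewrite lte_fin; have := exprn_gt0 2 e0; lra.
  apply: (le_trans Binf); apply: ereal_inf_lbound.
  by exists P, p; split.
move=> /ereal_sup_gt[_ [a /= a01 <-]]; rewrite in_itv/= in a01.
move=> lt; exists a => //.
have a01' : 0 < a <= 1 by case/andP: a01 => -> /ltW.
have iha : P0.-integrable setT (fun x => (h x `^ a)%:E).
  apply: powR_integrable => //; first exact: ratio_meas.
  by move=> x; exact: ratio_ge0.
have rE : int_ratio_pow P0 p pstar a = (\int[P0]_x (h x `^ a))%:E.
  rewrite /int_ratio_pow /Rintegral fineK; last exact: integrable_fin_num.
  by rewrite hE.
move: lt; rewrite rE; set r := Rintegral _ _ _.
have [r0|r0] := leP r 0; first by rewrite (le_lt_trans r0) ?expR_gt0.
rewrite lne_EFin// -EFinN lte_fin ltrNr => lt.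
by rewrite -[X in X < _]lnK ?posrE// ltr_expR.
Qed.

Lemma testing_set_rate (K : R) : 1 <= K -> exists2 a : R, 0 < a <= 1 &
  forall m (w : nat -> R) (h : nat -> X -> R),
  (forall j, 0 <= w j) -> (forall j, integrable_ratios (h j)) ->
  (\int[P0]_x ((\sum_(j < m) w j * Num.min (h j x) K) `^ a)%:E <=
   (expR (- (e ^+ 2 / 16)) * (\sum_(j < m) w j) `^ a)%:E)%E.
Proof.
move=> K1; have K0 : 0 <= K by exact: le_trans K1.
have s0 : 0 < e ^+ 2 / 16 by rewrite divr_gt0// exprn_gt0.
have [a a01 ha] := truncated_common_exponent ratio_meas (fun h x => @ratio_ge0 h x)
  ratio_int ratio_convex ratio_rate K1 s0.
exists a => // m w h w0 Gh; set W := \sum_(j < m) w j.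
have a_gt0 : 0 < a by case/andP: a01.
have : 0 <= W by exact: sumr_ge0.
rewrite le_eqVlt => /predU1P[W0|W0].
  have wj (j : 'I_m) : w j = 0.
    have : \sum_(j < m) w j == 0 by rewrite -/W -W0.
    by rewrite psumr_eq0// => /allP/(_ j); rewrite mem_index_enum => /(_ isT)/eqP.
  under eq_integral do under eq_bigr do rewrite wj mul0r.
  under eq_integral do rewrite big1// powR0 ?gt_eqF//.
  by rewrite integral0 lee_fin mulr_ge0 ?expR_ge0 ?powR_ge0.
have [k Gk kE] := finite_mixture ratio_convex w0 Gh W0.
have mk := ratio_meas Gk.
have mmin : measurable_fun setT (fun x => Num.min (k x) K).
  exact: measurable_minr.
have min0 x : 0 <= Num.min (k x) K by rewrite le_min K0 ratio_ge0.
have imin : P0.-integrable setT (fun x => (Num.min (k x) K `^ a)%:E).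
  apply: powR_integrable => //.
  apply: (@le_integrable _ _ _ _ _ measurableT _ (EFin \o k)).
  - exact/measurable_EFinP.
  - by move=> x _; rewrite lee_fin !ger0_norm ?ratio_ge0// ge_min lexx.
  - exact: ratio_int.
have mh j : measurable_fun setT (fun x => Num.min (h j x) K).
  by apply: measurable_minr => //; exact: ratio_meas.
apply: (@le_trans _ _ (\int[P0]_x ((W `^ a)%:E * (Num.min (k x) K `^ a)%:E))%E).
  apply: ge0_le_integral => //.
  - by move=> x _; rewrite lee_fin powR_ge0.
  - apply/measurable_EFinP; apply: (measurableT_comp (measurable_powR a)).
    by apply: measurable_sum => j; exact: measurable_funM.
  - by apply: emeasurable_funM => //; exact: (measurable_int P0).
  - move=> x _; rewrite -EFinM lee_fin -powRM ?(ltW W0)//.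
    have sum0 : 0 <= \sum_(j < m) w j * Num.min (h j x) K.
      by apply: sumr_ge0 => j _; rewrite mulr_ge0// le_min K0 ratio_ge0.
    apply: ge0_ler_powR; rewrite ?nnegrE ?(ltW a_gt0)//.
      by rewrite mulr_ge0// ltW.
    (* Truncation is concave: the weighted sum of truncated ratios is below W times the truncated
       mixture. *)
    rewrite minr_pMr ?(ltW W0)// le_min -kE; apply/andP; split.
      by apply: ler_sum => j _; rewrite ler_wpM2l// ge_min lexx.
    rewrite mulr_suml; apply: ler_sum => j _.
    by rewrite ler_wpM2l// ge_min lexx orbT.
rewrite integralZl// muleC EFinM lee_wpmul2r ?lee_fin ?powR_ge0//.
rewrite -[leLHS]fineK; last exact: integrable_fin_num.
rewrite lee_fin; apply: (le_trans (ha k Gk)).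
by rewrite -expRD ler_expR; lra.
Qed.

End testing_sets.

(** * Extended real inequalities *)

Section extended_reals.
Context {R : realType}.
Local Open Scope ereal_scope.
Implicit Types (a : nat -> \bar R).

(** The integral of a non-negative function is a supremum over simple functions below it, hence
    monotone without measurability. The posterior mass is integrated in this way. *)
Lemma ge0_le_integralT d (T : measurableType d) (m : {measure set T -> \bar R})
    (f h : T -> \bar R) : (forall x, 0 <= f x) -> (forall x, f x <= h x) ->
  \int[m]_x f x <= \int[m]_x h x.
Proof.
move=> f0 fh; rewrite !ge0_integralTE//; last by move=> x; exact: le_trans (fh x).
by apply: ereal_sup_le => _ /= [k kf <-]; exists k => // x; exact: le_trans (fh x).
Qed.

(** If some term reaches 1, so does the right side; otherwise no cap on the terms is active. *)
Lemma mine1_nneseries a : (forall i, 0 <= a i) ->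
  mine 1 (\sum_(i <oo) a i) <= \sum_(i <oo) mine 1 (a i).
Proof.
move=> a0; have m0 i : 0 <= mine 1 (a i) by rewrite le_min lee01 a0.
have [[i ai]|all1] := pselect (exists i, 1 <= a i).
  rewrite ge_min; apply/orP; left.
  apply: (@le_trans _ _ (\sum_(j < i.+1) mine 1 (a j))); last first.
    rewrite -(big_mkord xpredT (fun j => mine 1 (a j))).
    exact: nneseries_lim_ge.
  rewrite big_ord_recr/= (min_idPl ai) leeDr// sume_ge0//.
rewrite ge_min; apply/orP; right; apply: lee_nneseries => // i _.
by rewrite le_min lexx andbT leNgt; apply/negP => ai; apply: all1; exists i; exact: ltW.
Qed.

Lemma mine1_sum a N : (forall i, 0 <= a i) ->
  mine 1 (\sum_(i < N) a i) <= \sum_(i < N) mine 1 (a i).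
Proof.
move=> a0; have m0 i : 0 <= mine 1 (a i) by rewrite le_min lee01 a0.
elim: N => [|N ih]; first by rewrite !big_ord0 ge_min lexx orbT.
rewrite !big_ord_recr/=; apply: le_trans (leeD ih (lexx _)).
set s := \sum_(i < N) a i; have s0 : 0 <= s by exact: sume_ge0.
have [s1|s1] := leP 1 s; first by rewrite (@le_trans _ _ 1)// ?ge_min ?lexx// leeDl.
have [a1|a1] := leP 1 (a N); first by rewrite (@le_trans _ _ 1)// ?ge_min ?lexx// leeDr.
by rewrite ge_min lexx orbT.
Qed.

Lemma integral_le_cover d (T : measurableType d) (m : {measure set T -> \bar R})
    (S : set T) (D : nat -> set T) N (h : T -> \bar R) :
  measurable S -> (forall i, measurable (D i)) ->
  (forall x, S x -> exists i : 'I_N, D i x) ->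
  measurable_fun setT h -> (forall x, 0 <= h x) ->
  \int[m]_(x in S) h x <= \sum_(i < N) \int[m]_(x in D i) h x.
Proof.
move=> mS mD SD mh h0.
under eq_bigr do rewrite integral_mkcond.
rewrite integral_mkcond -ge0_integral_sum//; last 2 first.
- by move=> i; apply/(measurable_restrictT _ (mD i)); exact: measurable_funTS.
- by move=> i x _; rewrite patchE; case: ifP.
have P0 (A : set T) x : 0 <= (h \_ A) x by rewrite patchE; case: ifP.
apply: ge0_le_integralT => // x; rewrite [leLHS]patchE; case: ifPn => [|_]; last first.
  exact: sume_ge0.
rewrite inE => /SD[i Dix]; rewrite (bigD1 i)//= patchE mem_set// leeDl//.
exact: sume_ge0.
Qed.

Lemma ratio_le1 (u v : \bar R) : 0 <= u -> u <= v -> u / v <= 1.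
Proof.
case: v => [v| |] u0 uv; last 2 first.
- by rewrite invey mule0 lee01.
- by have := le_trans u0 uv.
have [v0|v0] := eqVneq v 0%R.
  rewrite v0 in uv *; have -> : u = 0 by apply/eqP; rewrite eq_le u0 uv.
  by rewrite mul0e lee01.
have vp : (0 < v)%R by rewrite lt_def v0 -lee_fin (le_trans u0 uv).
by rewrite inver (negbTE v0) lee_pdivrMr// mul1e.
Qed.

Lemma ratio_le (u v : \bar R) (r : R) : (0 < r)%R -> 0 <= u -> r%:E <= v ->
  u / v <= u * (r^-1)%:E.
Proof.
move=> r0 u0; case: v => [v| |]; last 2 first.
- by rewrite invey mule0 mule_ge0// lee_fin invr_ge0 ltW.
- by [].
rewrite lee_fin => rv; have v0 : (0 < v)%R by exact: lt_le_trans rv.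
by rewrite inver gt_eqF// lee_wpmul2l// lee_fin lef_pV2 ?posrE.
Qed.

End extended_reals.

(** * Bounds on the posterior mass *)

Section likelihood_ratios.
Context {R : realType} dX (X : measurableType dX) dM (Model : measurableType dM)
  dO (Omega : measurableType dO).
Variables (mu : {measure set X -> \bar R}) (P0 : probability X R)
  (law : Model -> probability X R) (dens : Model -> X -> R)
  (Pi : probability Model R) (Pstar : Model) (Pr : probability Omega R)
  (Xs : nat -> {mfun Omega >-> X}).
Hypothesis densP : forall P, is_density mu (law P) (dens P).
Hypothesis mdens : measurable_fun setT (fun z : X * Model => dens z.2 z.1).
Hypothesis Xs_iid : iid Pr P0 Xs.
Hypothesis ratio_fin : forall P, (\int[P0]_x (dens P x / dens Pstar x)%:E < +oo)%E.

Definition likelihood_ratio (P : Model) (x : X) : R := dens P x / dens Pstar x.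
Local Notation g := likelihood_ratio.

Definition partial_evidence (n : nat) (S : set Model) (w : Omega) : \bar R :=
  (\int[Pi]_(P in S) (\prod_(i < n) g P (Xs i w))%:E)%E.

Let mps : measurable_fun setT (dens Pstar). Proof. by have [] := densP Pstar. Qed.

Let dens0 P x : 0 <= dens P x. Proof. by have [_ + _] := densP P; apply. Qed.

Let g0 P x : 0 <= g P x. Proof. by rewrite divr_ge0. Qed.

Let mg : measurable_fun setT (fun z : X * Model => g z.2 z.1).
Proof.
apply: measurable_funM => //.
rewrite (_ : (fun z => _) = (fun z : X * Model => dens Pstar z.1 `^ (-1))).
  apply: (measurableT_comp (measurable_powR (-1))).
  exact: (measurableT_comp mps measurable_fst).
by apply/funext => z; rewrite powR_inv1.
Qed.

Let mgP P : measurable_fun setT (g P).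
Proof. exact: (measurableT_comp mg (pair2_measurable P)). Qed.

Let mlik n : measurable_fun setT
  (fun z : Omega * Model => (\prod_(i < n) g z.2 (Xs i z.1))%:E).
Proof. by apply/measurable_EFinP; exact: (measurable_likelihood Xs mg n). Qed.

Let mlikw n w : measurable_fun setT (fun P => (\prod_(i < n) g P (Xs i w))%:E).
Proof. exact: (measurableT_comp (mlik n) (pair1_measurable w)). Qed.

Let lik0 n P w : (0 <= (\prod_(i < n) g P (Xs i w))%:E)%E.
Proof. by rewrite lee_fin prodr_ge0. Qed.

Lemma partial_evidence_ge0 n S w : (0 <= partial_evidence n S w)%E.
Proof. by apply: integral_ge0 => P _; exact: lik0. Qed.

Lemma measurable_partial_evidence n S : measurable S ->
  measurable_fun setT (partial_evidence n S).
Proof.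
move=> mS; pose F (z : Omega * Model) :=
  ((\prod_(i < n) g z.2 (Xs i z.1))%:E * (\1_S z.2)%:E)%E.
have mF : measurable_fun setT F.
  apply: emeasurable_funM; first exact: mlik.
  have mI : measurable_fun setT (\1_S : Model -> R) by exact: measurable_indic.
  by apply/measurable_EFinP; exact: (measurableT_comp mI measurable_snd).
have F0 z : (0 <= F z)%E by rewrite mule_ge0// lee_fin indicE ler0n.
rewrite (_ : partial_evidence n S = fun w => \int[Pi]_P F (w, P))%E.
  exact: (measurable_fun_fubini_tonelli_F _ mF F0).
apply/funext => w; rewrite /partial_evidence integral_mkcond.
apply: eq_integral => P _; rewrite /F/= patchE indicE.
by case: ifP => _; rewrite ?mule1 ?mule0.
Qed.

Lemma measurable_KL_neighbourhood eps :
  measurable (KL_neighbourhood P0 dens Pstar eps).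
Proof.
pose F (z : X * Model) := lne (g z.2 z.1)%:E.
have mF : measurable_fun setT F by exact: measurable_lne_comp mg.
have mpos := measurable_funepos mF; have mneg := measurable_funeneg mF.
have mlog : measurable_fun setT (fun P => int_log_ratio P0 (dens P) (dens Pstar)).
  (* Tonelli gives measurability for non-negative integrands, hence the two parts. *)
  rewrite (_ : (fun P => _) = (fun P => \int[P0]_x F^\+ (x, P) - \int[P0]_x F^\- (x, P))%E).
    apply: emeasurable_funB.
      exact: (measurable_fun_fubini_tonelli_G _ mpos (fun z => funepos_ge0 F z)).
    exact: (measurable_fun_fubini_tonelli_G _ mneg (fun z => funeneg_ge0 F z)).
  apply/funext => P; rewrite /int_log_ratio integralE; congr (_ - _)%E.
    by apply: eq_integral => x _; rewrite !funeposE.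
  by apply: eq_integral => x _; rewrite !funenegE.
have msqr : measurable_fun setT (fun P => int_sqr_log_ratio P0 (dens P) (dens Pstar)).
  have mF2 : measurable_fun setT (fun z => (F z) ^+ 2)%E.
    by rewrite (_ : (fun z => _) = (fun z => F z * F z)%E)//; exact: emeasurable_funM.
  exact: (measurable_fun_fubini_tonelli_G _ mF2 (fun z => sqre_ge0 (F z))).
apply: (@measurableI _ _
  [set P | - int_log_ratio P0 (dens P) (dens Pstar) <= (eps ^+ 2)%:E]%E
  [set P | int_sqr_log_ratio P0 (dens P) (dens Pstar) <= (eps ^+ 2)%:E]%E).
  rewrite -[X in measurable X]setTI; apply: emeasurable_fun_infty_c => //.
  exact: measurableT_comp.
by rewrite -[X in measurable X]setTI; exact: emeasurable_fun_infty_c.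
Qed.

Lemma evidence_KL_neighbourhood n eps : (0 < n)%N -> 0 < eps ->
  (0 < Pi (KL_neighbourhood P0 dens Pstar eps))%E ->
  (Pr [set w | partial_evidence n setT w <
      (expR (- (2 * n%:R * eps ^+ 2)) *
       fine (Pi (KL_neighbourhood P0 dens Pstar eps)) / 2)%:E] <=
   (2 / (n%:R * eps ^+ 2))%:E)%E.
Proof.
move=> n0 eps0 KL0; have e20 : 0 < eps ^+ 2 by rewrite exprn_gt0.
have mKL := measurable_KL_neighbourhood eps.
apply: (evidence_lower_bound (Pr := Pr) (Xs := Xs) mg g0 mKL KL0 e20 n0).
move=> P [Elog Vlog].
have [N0 ilog Elog' Vlog'] := log_ratio_moments (@mgP P) (@g0 P) Elog Vlog.
exact: (chebyshev_likelihood Xs_iid).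
Qed.

(** The trace of each piece on the model is enlarged to a measurable hull, to which [mixture_bound]
    applies; capped masses are subadditive over the N hulls, which may overlap. *)
Lemma testing_cover_bound d e N S n d0 : 0 < e -> 0 < d0 ->
  testing_cover mu P0 law d (dens Pstar) Pstar e N -> measurable S ->
  (forall P, S P -> e < d P Pstar < 2 * e) ->
  (\int[Pr]_w mine 1 (partial_evidence n S w * (d0^-1)%:E) <=
   (N%:R * (Num.max 1 d0^-1 * expR (- (e ^+ 2 / 16)) ^+ n))%:E)%E.
Proof.
move=> e0 d0_gt0 [B [Btest Bcover]] mS Sd.
have /choice[D hD] (i : nat) : exists D : set Model, [/\ measurable D,
    forall P, (exists k : 'I_N, k = i :> nat /\ B k (law P)) -> D P &
    (\int[Pr]_w mine 1 (partial_evidence n D w * (d0^-1)%:E) <=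
      (Num.max 1 d0^-1 * expR (- (e ^+ 2 / 16)) ^+ n)%:E)%E].
  pose A := [set P | exists k : 'I_N, k = i :> nat /\ B k (law P)].
  have [D [mD AD hull]] := measurable_hull Pi A.
  exists D; split => //.
  apply: (mixture_bound Xs_iid mg g0 mD hull (expR_ge0 _) _ n d0_gt0).
  (* From index N on the trace is empty, so any exponent will do. *)
  move=> K K1; have [iN|iN] := ltnP i N; last first.
    exists 1; first by rewrite ltr01 lexx.
    move=> m w t _ /(_ 0%N)[k [ki _]].
    by move: (ltn_ord k); rewrite ki ltnNge iN.
  have [a a01 ha] := testing_set_rate (fun x => dens0 Pstar x) e0
    (Btest (Ordinal iN)) K1.
  exists a => // m w t w0 At; apply: (ha m w (fun j => g (t j))) => // j.
  have [k [ki Bk]] := At j.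
  exists (law (t j)), (dens (t j)); split => //.
    by rewrite (_ : Ordinal iN = k)//; exact: val_inj.
  apply/integrableP; split; first by apply/measurable_EFinP; exact: mgP.
  by under eq_integral do rewrite gee0_abs ?lee_fin ?g0//; exact: ratio_fin.
have SD P : S P -> exists i : 'I_N, D i P.
  by move=> /Sd/Bcover[i Bi]; exists i; case: (hD i) => _ + _; apply; exists i.
have d0i : (0 <= (d0^-1)%:E)%E by rewrite lee_fin invr_ge0 ltW.
have mD i : measurable (D i) by case: (hD i).
pose a i w := (partial_evidence n (D i) w * (d0^-1)%:E)%E.
have a0 i w : (0 <= a i w)%E by rewrite mule_ge0// partial_evidence_ge0.
have ma i : measurable_fun setT (fun w => mine 1%E (a i w)).
  apply: measurable_mine => //; apply: emeasurable_funM => //.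
  exact: measurable_partial_evidence.
apply: (@le_trans _ _ (\int[Pr]_w (\sum_(i < N) mine 1 (a i w)))%E).
  apply: ge0_le_integralT => w.
    by rewrite le_min lee01 mule_ge0// partial_evidence_ge0.
  apply: le_trans (mine1_sum N (fun i => a0 i w)).
  rewrite le_min ge_min lexx/= ge_min; apply/orP; right.
  rewrite -ge0_sume_distrl; last by move=> i _; exact: partial_evidence_ge0.
  by rewrite lee_wpmul2r//; apply: integral_le_cover.
rewrite ge0_integral_sum//; last by move=> i w _; rewrite le_min lee01 a0.
rewrite [leRHS](_ : _ = \sum_(i < N) (Num.max 1 d0^-1 * expR (- (e ^+ 2 / 16)) ^+ n)%:E)%E.
  by apply: lee_sum => i _; case: (hD i).
by rewrite sumEFin sumr_const card_ord mulr_natl.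
Qed.

Lemma posterior_le n (U : set Model) w d0 : measurable U -> 0 < d0 ->
  (forall i, dens Pstar (Xs i w) != 0) -> (d0%:E <= partial_evidence n setT w)%E ->
  (posterior Pi dens n (fun i => Xs i w) U <=
   mine 1 (partial_evidence n U w * (d0^-1)%:E))%E.
Proof.
move=> mU d0_gt0 ps0 hd0.
pose q := \prod_(i < n) dens Pstar (Xs i w).
have q0 : 0 < q by apply: prodr_gt0 => i _; rewrite lt_def ps0 dens0.
have scale S : measurable S ->
    (\int[Pi]_(P in S) (\prod_(i < n) dens P (Xs i w))%:E =
     q%:E * partial_evidence n S w)%E.
  move=> mS; rewrite /partial_evidence -ge0_integralZl_EFin// ?(ltW q0)//.
    apply: eq_integral => P _; rewrite -EFinM -big_split/=; congr (_%:E).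
    by apply: eq_bigr => i _; rewrite /g mulrC mulfVK.
  exact: measurable_funTS.
have den0 S := partial_evidence_ge0 n S w.
rewrite /posterior !scale//.
have UT : (partial_evidence n U w <= partial_evidence n setT w)%E.
  by apply: ge0_subset_integral => //; exact: measurable_funTS.
have -> : ((q%:E * partial_evidence n U w) / (q%:E * partial_evidence n setT w) =
    partial_evidence n U w / partial_evidence n setT w)%E.
  (* An infinite evidence makes both quotients 0, since +oo has inverse 0. *)
  move: (den0 U) UT hd0; case: (partial_evidence n setT w) => [r| |]//; last first.
    by move=> _ _ _; rewrite gt0_muley ?lte_fin// invey !mule0.
  case: (partial_evidence n U w) => [u| |]// _ _; rewrite lee_fin => d0r.
  have r0 : 0 < r by exact: lt_le_trans d0r.
  rewrite -!EFinM !inver mulf_eq0 !gt_eqF//= -!EFinM; congr (_%:E); field.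
  by rewrite !gt_eqF.
by rewrite le_min ratio_le// ratio_le1.
Qed.

Lemma posterior_le1 n (U : set Model) w : measurable U ->
  (posterior Pi dens n (fun i => Xs i w) U <= 1)%E.
Proof.
move=> mU; have mprod : measurable_fun setT
    (fun P => (\prod_(i < n) dens P (Xs i w))%:E).
  apply/measurable_EFinP; apply: measurable_prod => i _.
  exact: (measurableT_comp mdens (pair1_measurable (Xs i w))).
have prod0 P : (0 <= (\prod_(i < n) dens P (Xs i w))%:E)%E by rewrite lee_fin prodr_ge0.
apply: ratio_le1; first by apply: integral_ge0 => P _.
by apply: ge0_subset_integral => //; exact: measurable_funTS.
Qed.

Lemma posterior_ge0 n (U : set Model) w :
  (0 <= posterior Pi dens n (fun i => Xs i w) U)%E.
Proof.
by apply: mule_ge0; rewrite ?inve_ge0; apply: integral_ge0 => P _;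
  rewrite lee_fin prodr_ge0.
Qed.

(** * Shells around the centre [Pstar] *)

Variable d : Model -> Model -> R.
Hypothesis mball : forall r : R, 0 < r -> measurable [set P | r <= d P Pstar].

(** With e = (k + 2) u, each shell lies in e < d < 2 e, because k + 2 < k + 3 and k + 4 <= 2 (k +
    2). Shells of constant width thus fit the open annuli of the covering condition. *)
Definition annulus (u : R) (k : nat) : set Model :=
  [set P | (k%:R + 3) * u <= d P Pstar < (k%:R + 4) * u].

Lemma measurable_annulus u k : 0 < u -> measurable (annulus u k).
Proof.
move=> u0; rewrite (_ : annulus u k = [set P | (k%:R + 3) * u <= d P Pstar] `\`
    [set P | (k%:R + 4) * u <= d P Pstar]).
  by apply: measurableD; apply: mball; rewrite mulr_gt0// ltr_wpDl.
apply/seteqP; split => P; rewrite /annulus/=.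
  by move=> /andP[h1 h2]; split => //; apply/negP; rewrite -ltNge.
by move=> [-> /negP]; rewrite -ltNge.
Qed.

Lemma bigcup_annulus u : 0 < u ->
  \bigcup_k annulus u k = [set P | 3 * u <= d P Pstar].
Proof.
move=> u0; apply/seteqP; split => P /=.
  move=> [k _ /andP[+ _]]; apply: le_trans.
  by rewrite ler_pM2r// lerDr.
move=> hP; pose y := d P Pstar / u.
have y3 : 3 <= y by rewrite ler_pdivlMr.
have y0 : 0 <= y by rewrite (le_trans _ y3).
have /andP[ty yt] := truncn_itv y0.
have t3 : (3 <= Num.truncn y)%N.
  by rewrite -ltnS -(ltr_nat R); exact: le_lt_trans y3 yt.
exists (Num.truncn y - 3)%N => //; rewrite /annulus/=.
rewrite natrB// subrK -ler_pdivlMr// ty/= -ltr_pdivrMr//.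
by move: yt; rewrite -natr1; set t := _%:R; rewrite -/y; lra.
Qed.

Lemma annulus_inj u k l P : 0 < u -> annulus u k P -> annulus u l P -> (k <= l)%N.
Proof.
move=> u0 /andP[kP _] /andP[_ lP]; have := le_lt_trans kP lP.
rewrite ltr_pM2r// => h; rewrite -ltnS -(ltr_nat R) -natr1.
by lra.
Qed.

Lemma annuli_bound n d0 u (b : nat -> \bar R) : 0 < u -> 0 < d0 ->
  (forall k, \int[Pr]_w mine 1 (partial_evidence n (annulus u k) w * (d0^-1)%:E)
    <= b k)%E ->
  (\int[Pr]_w mine 1 (partial_evidence n [set P | 3 * u <= d P Pstar]%R w * (d0^-1)%:E)
    <= \sum_(k <oo) b k)%E.
Proof.
move=> u0 d0_gt0 hb.
have d0i : (0 <= (d0^-1)%:E)%E by rewrite lee_fin invr_ge0 ltW.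
have mA k : measurable (annulus u k) by exact: measurable_annulus.
pose a k w := (partial_evidence n (annulus u k) w * (d0^-1)%:E)%E.
have a0 k w : (0 <= a k w)%E by rewrite mule_ge0// partial_evidence_ge0.
have ma k : measurable_fun setT (fun w => mine 1%E (a k w)).
  apply: measurable_mine => //; apply: emeasurable_funM => //.
  exact: measurable_partial_evidence.
have ma0 k w : (0 <= mine 1 (a k w))%E by rewrite le_min lee01 a0.
have split_annuli w : (partial_evidence n [set P | 3 * u <= d P Pstar]%R w *
    (d0^-1)%:E = \sum_(k <oo) a k w)%E.
  rewrite /partial_evidence -bigcup_annulus// ge0_integral_bigcup//.
  - rewrite muleC -nneseriesZl; last by move=> k _; exact: partial_evidence_ge0.
    by apply: eq_eseriesr => k _; rewrite muleC.
  - exact: measurable_funTS.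
  - apply/trivIsetP => k l _ _ kl; apply/seteqP; split => // P [kP lP].
    by move/eqP: kl; apply; apply/eqP; rewrite eqn_leq;
      apply/andP; split; [exact: annulus_inj kP lP|exact: annulus_inj lP kP].
apply: (@le_trans _ _ (\int[Pr]_w (\sum_(k <oo) mine 1 (a k w)))%E).
  apply: ge0_le_integralT => w.
    by rewrite le_min lee01/= split_annuli nneseries_ge0.
  by rewrite split_annuli; exact: mine1_nneseries.
rewrite integral_nneseries//.
by apply: lee_nneseries => [k _ _|k _]; [apply: integral_ge0 => w _|exact: hb].
Qed.

End likelihood_ratios.

(** Budget of the exponent: x for the number of pieces, (2 + L) x for the evidence, 2 x to gain 1 /
    x, hence (L + 5) x; a further k + 1 makes the bounds summable over shells. The factor C^2 / 9
    from e^2 over 16 is (C / 12)^2, hence the 12. *)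
Lemma annulus_mass_numeric {R : realType} (x L C e N : R) (k n : nat) :
  1 <= x -> 0 < L -> 12 * (L + 5) <= C -> 0 <= N -> N <= expR x + 1 ->
  n%:R * e ^+ 2 = (k%:R + 2) ^+ 2 * (C / 3) ^+ 2 * x ->
  N * (Num.max 1 (expR (- ((2 + L) * x)) / 2)^-1 * expR (- (e ^+ 2 / 16)) ^+ n) <=
  4 / x / (2 ^ k.+1)%:R.
Proof.
move=> x1 L0 LC N0 Nx ne.
have x0 : 0 < x by lra.
have -> : (expR (- ((2 + L) * x)) / 2)^-1 = 2 * expR ((2 + L) * x).
  by rewrite invfM invrK expRN invrK mulrC.
have Lx0 : 0 <= (2 + L) * x by rewrite mulr_ge0// ltW//; lra.
have -> : Num.max 1 (2 * expR ((2 + L) * x)) = 2 * expR ((2 + L) * x).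
  apply/max_idPr; have : 1 <= expR ((2 + L) * x) by rewrite -{1}expR0 ler_expR.
  by lra.
rewrite -expRM_natl.
have C2 : (L + 5) <= (C / 12) ^+ 2.
  have h : L + 5 <= C / 12 by lra.
  apply: (le_trans h); rewrite expr2 ler_peMl; lra.
(* With y = (C / 12)^2 x >= 1, one of k + 2 copies of y pays for (L + 5) x and the others for k +
   1. *)
have exponent : (L + 5) * x + k.+1%:R <= n%:R * (e ^+ 2 / 16).
  rewrite mulrA ne; have -> : (k%:R + 2) ^+ 2 * (C / 3) ^+ 2 * x / 16 =
    (k%:R + 2) ^+ 2 * ((C / 12) ^+ 2 * x) by field.
  have k0 : 0 <= k%:R :> R by [].
  have Lx : (L + 5) * x <= (C / 12) ^+ 2 * x by rewrite ler_pM2r.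
  have L1 : 1 <= (L + 5) * x by rewrite (le_trans x1)// ler_peMl//; lra.
  have y1 : 1 <= (C / 12) ^+ 2 * x by exact: le_trans Lx.
  rewrite -natr1; set y := (C / 12) ^+ 2 * x in Lx y1 *.
  have ky : k%:R <= k%:R * y by rewrite ler_peMr.
  have k2 : k%:R + 2 <= (k%:R + 2) ^+ 2 :> R by rewrite expr2 ler_peMl; lra.
  have h : (k%:R + 2) * y <= (k%:R + 2) ^+ 2 * y by rewrite ler_wpM2r// (le_trans ler01).
  by lra.
have N2 : N <= 2 * expR x.
  have : 1 <= expR x by rewrite -expR0 ler_expR ltW.
  by lra.
apply: (@le_trans _ _ (2 * expR x * (2 * expR ((2 + L) * x) *
    expR (- ((L + 5) * x + k.+1%:R))))).
  apply: ler_pM => //.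
  rewrite ler_wpM2l ?mulr_ge0 ?expR_ge0// ler_expR.
  by rewrite mulrN lerN2.
have -> : 2 * expR x * (2 * expR ((2 + L) * x) * expR (- ((L + 5) * x + k.+1%:R))) =
    4 * (expR (- (2 * x)) * expR (- k.+1%:R)).
  rewrite -expRD (_ : - (2 * x) - k.+1%:R = x + ((2 + L) * x - ((L + 5) * x + k.+1%:R))).
    by rewrite !expRD; ring.
  by ring.
rewrite -!mulrA ler_pM2l//; apply: ler_pM; rewrite ?expR_ge0//.
  rewrite expRN lef_pV2 ?posrE ?expR_gt0//.
  by apply: le_trans (expR_ge1Dx _); lra.
rewrite expRN lef_pV2 ?posrE ?expR_gt0 ?ltr0n ?expn_gt0//.
have -> : expR k.+1%:R = expR 1 ^+ k.+1 :> R by rewrite -expRM_natl mulr1.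
rewrite natrX lerXn2r ?nnegrE ?expR_ge0//.
by apply: le_trans (expR_ge1Dx _); lra.
Qed.

(** * The expected posterior mass at a fixed sample size *)

Section posterior_contraction.
Context {R : realType} dX (X : measurableType dX) dM (Model : measurableType dM)
  dO (Omega : measurableType dO).
Variables (mu : {measure set X -> \bar R}) (P0 : probability X R)
  (law : Model -> probability X R) (dens : Model -> X -> R)
  (d : Model -> Model -> R) (Pi : probability Model R) (Pstar : Model)
  (Pr : probability Omega R) (Xs : nat -> {mfun Omega >-> X}).
Hypothesis densP : forall P, is_density mu (law P) (dens P).
Hypothesis mdens : measurable_fun setT (fun z : X * Model => dens z.2 z.1).
Hypothesis mball : forall r : R, 0 < r -> measurable [set P | r <= d P Pstar].
Hypothesis Xs_iid : iid Pr P0 Xs.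
Hypothesis ratio_fin : forall P, (\int[P0]_x (dens P x / dens Pstar x)%:E < +oo)%E.
Hypothesis pstar_null : P0 [set x | dens Pstar x = 0] = 0%E.

Lemma expected_posterior_bound (n : nat) (eps L C : R) :
  (0 < n)%N -> 0 < eps -> 0 < L -> 12 * (L + 5) <= C -> 1 <= n%:R * eps ^+ 2 ->
  ((expR (- (L * n%:R * eps ^+ 2)))%:E <=
    Pi (KL_neighbourhood P0 dens Pstar eps))%E ->
  (forall e : R, eps < e ->
    (testing_covering_number mu P0 law d (dens Pstar) Pstar e <=
      (expR (n%:R * eps ^+ 2))%:E)%E) ->
  (\int[Pr]_w posterior Pi dens n (fun i => Xs i w)
     [set P : Model | (C * eps <= d P Pstar)%R] <= (6 / (n%:R * eps ^+ 2))%:E)%E.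
Proof.
move=> n0 eps0 L0 LC x1 KL_large cover.
set x := n%:R * eps ^+ 2 in x1 cover *.
have x0 : 0 < x by lra.
pose u := C * eps / 3.
have C0 : 0 < C by lra.
have u0 : 0 < u by rewrite divr_gt0// mulr_gt0.
have u3 : 3 * u = C * eps by rewrite /u; field.
rewrite -u3; set U := [set P | _].
have mU : measurable U by apply: mball; rewrite mulr_gt0.
(* The evidence bound exp(- 2 x) Pi(B) / 2 with the prior mass replaced by its lower bound exp(- L
   x). *)
pose d0 := expR (- ((2 + L) * x)) / 2.
have d0_gt0 : 0 < d0 by rewrite divr_gt0// expR_gt0.
have d0i : (0 <= (d0^-1)%:E)%E by rewrite lee_fin invr_ge0 ltW.
pose D n S w := partial_evidence dens Pi Pstar Xs n S w.
have mD S : measurable S -> measurable_fun setT (D n S).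
  exact: (measurable_partial_evidence Pi Pstar Xs densP mdens n).
have [mZ Z0] : measurable (\bigcup_i (Xs i @^-1` [set x | dens Pstar x = 0])) /\
    Pr (\bigcup_i (Xs i @^-1` [set x | dens Pstar x = 0])) = 0%E.
  apply: (iid_null_events Xs_iid) => //.
  rewrite -[X in measurable X]setTI; have [mps _ _] := densP Pstar.
  by apply: (mps measurableT [set 0]); exact: measurable_set1.
set Z := \bigcup_i _ in mZ Z0.
pose Low := [set w | (D n setT w < d0%:E)%E].
have mLow : measurable Low.
  by rewrite -[Low]setTI; apply: emeasurable_fun_infty_o => //; exact: mD.
have PLow : (Pr Low <= (2 / x)%:E)%E.
  have KL0 : (0 < Pi (KL_neighbourhood P0 dens Pstar eps))%E.
    by apply: lt_le_trans KL_large; rewrite lte_fin expR_gt0.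
  apply: le_trans (evidence_KL_neighbourhood densP mdens Xs_iid n0 eps0 KL0).
  apply: le_measure; rewrite ?inE//.
    rewrite -[X in measurable X]setTI; apply: emeasurable_fun_infty_o => //.
    exact: mD.
  move=> w /= /lt_le_trans; apply; rewrite lee_fin ler_pM2r ?invr_gt0//.
  have -> : - ((2 + L) * x) = - (2 * n%:R * eps ^+ 2) + - (L * n%:R * eps ^+ 2).
    by rewrite /x; ring.
  rewrite expRD ler_wpM2l ?expR_ge0// -lee_fin fineK//.
  by rewrite fin_num_measure//; exact: measurable_KL_neighbourhood densP mdens eps.
pose near_mass w := mine 1%E (D n U w * (d0^-1)%:E)%E.
have mmass : measurable_fun setT near_mass.
  by apply: measurable_mine => //; apply: emeasurable_funM => //; exact: mD.
have mass0 w : (0 <= near_mass w)%E.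
  by rewrite le_min lee01 mule_ge0// (partial_evidence_ge0 Pi Pstar Xs densP).
have massB : (\int[Pr]_w near_mass w <= (4 / x)%:E)%E.
  apply: (le_trans (annuli_bound densP mdens mball u0 d0_gt0
    (b := fun k => ((4 / x) / (2 ^ k.+1)%:R)%:E) _)); last first.
    by apply: (epsilon_trick0 xpredT); rewrite divr_ge0// ltW.
  move=> k; pose e := (k%:R + 2) * u.
  have k0 : 0 <= k%:R :> R by [].
  have epse : eps < e.
    have h : eps < 2 * u by rewrite /u; have := mulr_gt0 eps0 C0; nra.
    by apply: lt_le_trans h _; rewrite /e ler_pM2r// lerDr.
  have e0 : 0 < e by exact: lt_trans epse.
  (* Adding 1 makes the inequality strict, so that the infimum yields an actual cover. *)
  have /ereal_inf_lt[_ [N Ncover <-]] : (testing_covering_number mu P0 law d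
      (dens Pstar) Pstar e < (expR x + 1)%:E)%E.
    by apply: (le_lt_trans (cover e epse)); rewrite lte_fin ltrDl.
  rewrite lte_fin => Nx.
  have annulus_e P : annulus Pstar d u k P -> e < d P Pstar < 2 * e.
    move=> /andP[P1 P2]; apply/andP; split.
      by apply: lt_le_trans P1; rewrite ltr_pM2r// ltrD2l ltr_nat.
    by apply: (lt_le_trans P2); rewrite /e mulrA ler_pM2r//; lra.
  apply: (le_trans (testing_cover_bound Pi densP mdens Xs_iid ratio_fin n e0 d0_gt0
    Ncover (measurable_annulus mball k u0) annulus_e)).
  rewrite lee_fin; apply: (annulus_mass_numeric x1 L0 LC) => //; first exact: ltW.
  by rewrite /e /u /x; field.
(* The trivial bound 1 is used on the null event where [pstar] vanishes and on the event of small
   evidence. Their cost 2 / x and the 4 / x of the shells add up to 6 / x. *)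
have pointwise w : (posterior Pi dens n (fun i => Xs i w) U <=
    (\1_Z w)%:E + (\1_Low w)%:E + near_mass w)%E.
  have [Zw|nZw] := pselect (Z w).
    apply: le_trans (posterior_le1 Pi Xs densP mdens n w mU) _.
    by rewrite indicE mem_set// -addeA leeDl// adde_ge0// lee_fin indicE ler0n.
  have [Lw|nLw] := pselect (Low w).
    apply: le_trans (posterior_le1 Pi Xs densP mdens n w mU) _.
    rewrite (indicE _ Low) mem_set//= [X in (X + _)%E]addeC -addeA leeDl// adde_ge0//.
  apply: (@le_trans _ _ (near_mass w)); last first.
    by rewrite leeDr// adde_ge0// lee_fin indicE ler0n.
  apply: (posterior_le densP mdens mU d0_gt0).
    by move=> i; apply/eqP => psi; apply: nZw; exists i.
  by rewrite leNgt; apply/negP.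
have mI A : measurable A -> measurable_fun setT (fun w : Omega => (\1_A w : R)%:E).
  by move=> mA; apply/measurable_EFinP; exact: measurable_indic.
have I0 A (w : Omega) : (0 <= (\1_A w : R)%:E)%E by rewrite lee_fin indicE ler0n.
apply: (@le_trans _ _ (\int[Pr]_w ((\1_Z w)%:E + (\1_Low w)%:E + near_mass w))%E).
  by apply: ge0_le_integralT => // w; exact: (posterior_ge0 Pi Xs densP).
rewrite ge0_integralD//; last 2 first.
- by move=> w _; rewrite adde_ge0.
- by apply: emeasurable_funD; exact: mI.
rewrite ge0_integralD//; try exact: mI.
have IZ : (\int[Pr]_w (\1_Z w)%:E = 0)%E by rewrite integral_indic// setIT.
have ILow : (\int[Pr]_w (\1_Low w)%:E = Pr Low)%E by rewrite integral_indic// setIT.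
rewrite IZ ILow add0e; apply: (le_trans (leeD PLow massB)); rewrite -EFinD lee_fin.
by rewrite -mulrDl ler_pM2r ?invr_gt0//; lra.
Qed.

End posterior_contraction.

(** * Passage to the limit *)

Local Open Scope ereal_scope.

Theorem theorem2p1 (R : realType)
    (* the sample space, the dominating measure and the true distribution *)
    (dX : measure_display) (X : measurableType dX)
    (mu : {sigma_finite_measure set X -> \bar R})
    (P0 : probability X R) (p0 : X -> R)
    (* the model: a collection of distributions (the image of the injection
       [law]) carrying the sigma-field of [Model], and its mu-densities *)
    (dM : measure_display) (Model : measurableType dM)
    (law : Model -> probability X R) (dens : Model -> X -> R)
    (d : Model -> Model -> R)
    (Pi : probability Model R) (Pstar : Model)
    (eps : nat -> R) (L : R)
    (* i.i.d. observations from P0 *)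
    (dO : measure_display) (Omega : measurableType dO)
    (Pr : probability Omega R) (Xs : nat -> {mfun Omega >-> X}) :
  is_density mu P0 p0 ->
  (forall P Q : Model,
    (forall A, measurable A -> law P A = law Q A) -> P = Q) ->
  (forall P : Model, is_density mu (law P) (dens P)) ->
  measurable_fun setT (fun z : X * Model => dens z.2 z.1) ->
  is_semimetric d ->
  (forall r : R, (0 < r)%R -> measurable [set P : Model | (r <= d P Pstar)%R]) ->
  iid Pr P0 Xs ->
  - int_log_ratio P0 (dens Pstar) p0 < +oo ->
  (forall P : Model, \int[P0]_x (dens P x / dens Pstar x)%:E < +oo) ->
  (forall n, (0 < n)%N -> (0 < eps n)%R) ->
  eps n @[n --> \oo] --> (0 : R)%R ->
  (n%:R * eps n ^+ 2)%R @[n --> \oo] --> +oo%R ->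
  (0 < L)%R ->
  (forall n, (0 < n)%N ->
    (expR (- (L * n%:R * eps n ^+ 2)))%:E <=
      Pi (KL_neighbourhood P0 dens Pstar (eps n))) ->
  (forall n, (0 < n)%N -> forall e : R, (eps n < e)%R ->
    testing_covering_number mu P0 law d (dens Pstar) Pstar e <=
      (expR (n%:R * eps n ^+ 2))%:E) ->
  exists M0 : R, forall M : R, (M0 <= M)%R ->
    (\int[Pr]_w posterior Pi dens n (fun i => Xs i w)
       [set P : Model | (M * eps n <= d P Pstar)%R]) @[n --> \oo] --> 0.
Proof.
move=> p0P _ densP mdens _ mball Xs_iid KLstar ratio_fin eps0 _ ncvg L0 prior cover.
(* The finite divergence makes the ratio of the density of [Pstar] to [p0] positive P0-almost
   everywhere, and this ratio vanishes wherever its numerator does. *)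
have pstar_null : P0 [set x | dens Pstar x = 0%R] = 0.
  have [mp0 p0_ge0 _] := p0P; have [mps ps_ge0 _] := densP Pstar.
  have mratio : measurable_fun setT (fun x => dens Pstar x / p0 x)%R.
    apply: measurable_funM => //.
    rewrite (_ : (fun x => _) = (fun x => p0 x `^ (-1))%R).
      exact: (measurableT_comp (measurable_powR (-1)%R) mp0).
    by apply/funext => x; rewrite powR_inv1.
  have ratio0 x : (0 <= dens Pstar x / p0 x)%R by rewrite divr_ge0.
  have mzero (f : X -> R) : measurable_fun setT f -> measurable [set x | f x = 0%R].
    move=> mf; rewrite -[X in measurable X]setTI; apply: (mf measurableT [set 0%R]).
    exact: measurable_set1.
  apply/eqP; rewrite eq_le measure_ge0 andbT -(log_ratio_pos mratio ratio0 KLstar).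
  apply: le_measure; rewrite ?inE; [exact: mzero|exact: mzero|].
  by move=> x /= ->; rewrite mul0r.
exists (12 * (L + 5))%R => C LC.
have mass0 n : 0 <= \int[Pr]_w posterior Pi dens n (fun i => Xs i w)
    [set P : Model | (C * eps n <= d P Pstar)%R].
  by apply: integral_ge0 => w _; exact: (posterior_ge0 Pi Xs densP).
apply: (@squeeze_cvge _ _ _ _ (fun=> 0) _ (fun n => (6 / (n%:R * eps n ^+ 2))%:E)).
- have : \forall n \near \oo, (1 <= n%:R * eps n ^+ 2)%R.
    by move/cvgryPge: ncvg; exact.
  move=> x1; near=> n.
  have n0 : (0 < n)%N by near: n; exact: nbhs_infty_gt.
  rewrite mass0/=.
  apply: (expected_posterior_bound densP mdens mball Xs_iid ratio_fin pstar_null n0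
    (eps0 n n0) L0 LC _ (prior n n0) (cover n n0)).
  by near: n.
- exact: cvg_cst.
- apply/cvg_EFin; first by near=> n.
  rewrite -[X in _ --> X](mulr0 (6%R : R)); apply: cvgM; first exact: cvg_cst.
  apply/gtr0_cvgV0 => //.
  near=> n; rewrite mulr_gt0 ?ltr0n ?exprn_gt0 ?eps0//.
    near: n; exact: nbhs_infty_gt.
  near: n; exact: nbhs_infty_gt.
Unshelve. all: by end_near. Qed.
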